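(* Let $a>0$, $a\neq 1$. There is a constant $C>0$ depending only on $a$ such that the following holds. Let $u(t,x)=e^{it|D|^a}u_0(x)$ with $u_0\in\dot H^{\frac{1-a}{2}}(\mathbb{R})$ and $Lu_0\in \dot H^{\frac{1-a}{2}}(\mathbb{R})$. Then for every time $t>0$ and every real $y$ ($y\ne 0$ if $0<a<1$), $$|u(t,yt^{1/a})|\le C\left(1+|y|^{\frac{-a}{4(1-a)}}\right)t^{-1/2}\left(\|u_0\|_{\dot H^{\frac{1-a}{2}}}+\|Lu_0\|_{\dot H^{\frac{1-a}{2}}}\right).$$
   Context: $u=e^{it|D|^a}u_0$ is the solution on $\mathbb{R}_t\times\mathbb{R}_x$ of $\partial_t u-i|D|^a u=0$, $u(0,x)=u_0(x)$, i.e. (up to the normalization constant of the Fourier transform) $u(t,x)=\int e^{i(x\xi+t|\xi|^a)}\widehat{u_0}(\xi)\,d\xi$, where $|D|^a$ is the Fourier multiplier with symbol $|\xi|^a$. $L=t\partial_t+\frac{x}{a}\partial_x$ is the scaling vector field and $Lu_0:=(Lu)(0,x)$, i.e. $Lu_0=\frac{x}{a}\partial_xu_0$. The homogeneous Sobolev norm is $\|f\|_{\dot H^s}=\left(\int|\xi|^{2s}|\widehat f(\xi)|^2d\xi\right)^{1/2}$. *)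

(* Defs.v *)
From HB Require Import structures.
From mathcomp Require Import all_boot all_order all_algebra.
From mathcomp Require Import complex.
From mathcomp Require Import all_classical all_reals all_analysis.

Set Implicit Arguments.
Unset Strict Implicit.
Unset Printing Implicit Defensive.

Import Order.TTheory GRing.Theory Num.Theory.
Import numFieldNormedType.Exports.

Local Open Scope classical_set_scope.
Local Open Scope complex_scope.
Local Open Scope ring_scope.

Section ComplexCalculus.
Variable R : realType.
Implicit Types (f g : R -> R[i]) (D : set R).

Definition cabs (z : R[i]) : R := complex.Re `|z|.

Definition expi (theta : R) : R[i] := cos theta +i* sin theta.

Definition cintegrable D f : Prop :=
  (@lebesgue_measure R).-integrable D (fun x => (complex.Re (f x))%:E) /\
  (@lebesgue_measure R).-integrable D (fun x => (complex.Im (f x))%:E).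

Definition cintegral D f : R[i] :=
  (\int[@lebesgue_measure R]_(x in D) complex.Re (f x))%R +i*
  (\int[@lebesgue_measure R]_(x in D) complex.Im (f x))%R.

Definition clocally_integrable f : Prop :=
  locally_integrable setT (fun x => complex.Re (f x)) /\
  locally_integrable setT (fun x => complex.Im (f x)).

Definition cderivable f (x : R) : Prop :=
  derivable (fun x => complex.Re (f x)) x 1 /\
  derivable (fun x => complex.Im (f x)) x 1.

Definition cderive f : R -> R[i] := fun x =>
  derive1 (fun x => complex.Re (f x)) x +i*
  derive1 (fun x => complex.Im (f x)) x.

Definition cderiven (k : nat) f : R -> R[i] := iter k cderive f.

End ComplexCalculus.

Section TemperedDistributions.
Variable R : realType.
Implicit Types (f phi psi : R -> R[i]).

Definition schwartz phi : Prop := forall k : nat,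
  (forall x, cderivable (cderiven k phi) x) /\
  (forall j : nat, exists B : R,
    forall x, `|x| ^+ j * cabs (cderiven k phi x) <= B).

Definition schwartz_seminorm (j k : nat) phi : R :=
  sup [set `|x| ^+ j * cabs (cderiven k phi x) | x in [set: R]].

(* A distribution is represented by a functional on all functions R -> R[i],
   of which only the values on Schwartz functions are ever constrained. *)
Definition functional := (R -> R[i]) -> R[i].

Implicit Types T : functional.

Definition tempered T : Prop :=
  (forall (c : R[i]) phi psi, schwartz phi -> schwartz psi ->
    T (fun x => c * phi x + psi x) = c * T phi + T psi) /\
  (exists (N : nat) (M : R), forall phi, schwartz phi ->
    cabs (T phi) <= M * \sum_(j < N.+1) \sum_(k < N.+1)
                          schwartz_seminorm j k phi).

Definition dist_derive T : functional := fun phi => - T (cderive phi).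

Definition dist_mulx T : functional := fun phi => T (fun x => x%:C * phi x).

(* The trace at t = 0 of L = t d/dt + (x/a) d/dx. *)
Definition scaling_field (a : R) T : functional :=
  fun phi => (a^-1)%:C * dist_mulx (dist_derive T) phi.

(* The factor 1/(2 pi) makes f(x) = int e^{i x xi} (fourier f)(xi) d xi. *)
Definition fourier f : R -> R[i] := fun xi =>
  ((2 * pi)^-1)%:C * cintegral setT (fun x => expi (- (x * xi)) * f x).

Definition fourier_density T f : Prop :=
  clocally_integrable f /\
  forall phi, schwartz phi ->
    cintegrable setT (fun xi => f xi * phi xi) /\
    T (fourier phi) = cintegral setT (fun xi => f xi * phi xi).

(* The Fourier transform of T when it is a function; it is determined almost
   everywhere, and is 0 when T^ is not a function. *)
Definition dist_fourier T : R -> R[i] :=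
  xget (fun=> 0) [set f | fourier_density T f].

Definition hdot_energy (s : R) T : \bar R :=
  (\int[@lebesgue_measure R]_(xi in setT)
     ((`|xi| `^ (2 * s)) * cabs (dist_fourier T xi) ^+ 2)%:E)%E.

(* For s < 1/2, finiteness of the energy makes T^ locally integrable, so no
   element is lost by asking for a locally integrable density. *)
Definition hdot (s : R) T : Prop :=
  [/\ tempered T, exists f, fourier_density T f & (hdot_energy s T < +oo)%E].

Definition hdot_norm (s : R) T : R := Num.sqrt (fine (hdot_energy s T)).

Definition propagator_fourier (a t : R) T : R -> R[i] := fun xi =>
  expi (t * `|xi| `^ a) * dist_fourier T xi.

Definition truncated_solution (a : R) T (t x r : R) : R[i] :=
  cintegral `[- r, r] (fun xi => expi (x * xi) * propagator_fourier a t T xi).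

(* The inversion integral is only conditionally convergent: for T in
   hdot ((1 - a) / 2) the density need not be absolutely integrable at
   infinity. *)
Definition solution_converges (a : R) T (t x : R) : Prop :=
  cvg (complex.Re (truncated_solution a T t x r) @[r --> +oo]) /\
  cvg (complex.Im (truncated_solution a T t x r) @[r --> +oo]).

Definition solution (a : R) T (t x : R) : R[i] :=
  lim (complex.Re (truncated_solution a T t x r) @[r --> +oo]) +i*
  lim (complex.Im (truncated_solution a T t x r) @[r --> +oo]).

End TemperedDistributions.

(* Main.v *)
Require Import Defs.
From HB Require Import structures.
From mathcomp Require Import all_boot all_order all_algebra.
From mathcomp Require Import complex.
From mathcomp Require Import all_classical all_reals all_analysis.
From mathcomp Require Import measurable_realfun ring lra.

(* The relation between the Fourier transforms [f] of [u0] and [g] of [L u0] is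
   [(xi f)' = - a g] in the weak sense, so that [b f(b) = - a int_0^b g] for
   almost every [b].  Substituting this in the inversion integral and exchanging
   the integrals leaves [g] integrated against the kernels
   [int_s^q cos (x y + t y^a + theta) / y dy], which decay like [1 / (t s^a)]
   away from the stationary point [v] of the phase and like [1 / sqrt (t v^a)]
   near it.  A weighted Cauchy-Schwarz inequality then bounds each piece by
   [t^(-1/2)] times the norm of [L u0]; the piece below [t^(-1/a)] is bounded
   directly.  The bound so obtained is uniform in [y]. *)

Set Implicit Arguments.
Unset Strict Implicit.
Unset Printing Implicit Defensive.

Import Order.TTheory GRing.Theory Num.Theory.
Import numFieldNormedType.Exports.

Local Open Scope classical_set_scope.
Local Open Scope ring_scope.

(** * Smooth functions *)

Section Smooth.
Context {R : realType}.
Implicit Types f g : R -> R.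

(** The norm fits the scaling of the phase. By duality with its weight [s^(1 - a)], integrating [g]
    against a kernel [k] costs the square root of the integral of [s^(a - 1) k(s)^2]. For [k = 1] on
    [[0, p]] this is of order [p^(a/2)], so [f(y)] is controlled by [y^(a/2 - 1)]: a bound
    integrable at 0 but not at infinity, where oscillation has to supply convergence as well as
    decay. Below [t^(-1/a)] absolute integration already gives [t^(-1/2)]; above it, away from [v],
    the kernel yields [t^(-1) p^(-a/2)], at most [t^(-1/2)]; on the block from [v/2] to [2v] it
    yields [(t v^a)^(-1/2) v^(a/2)]. There [v] cancels, which is why the bound is uniform in [y]. A
    second obstacle is that the relation between [f] and [g] is only distributional: the constant of
    integration at 0 has to be excluded, and local integrability of [f] does this. All estimates
    concern real integrals over a positive half line; the shift [theta] covers real and imaginary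
    parts, and a reflection covers the negative frequencies. *)

Fixpoint differentiable_upto (n : nat) f : Prop :=
  if n is m.+1 then
    (forall x, derivable f x 1) /\ differentiable_upto m (derive1 f)
  else True.

(** Smoothness is the conjunction of all finite orders, so that each closure property is an
    induction on the order, with the factors of a derivative needed only at lower order. *)
Definition smooth f := forall n, differentiable_upto n f.

Lemma derivable_is_derive1 f (x : R) :
  derivable f x 1 -> is_derive x 1 f (derive1 f x).
Proof. by move=> h; rewrite derive1E; exact: DeriveDef. Qed.

Lemma is_derive_derive1 f f' :
  (forall x : R, is_derive x 1 f (f' x)) -> derive1 f = f'.
Proof.
by move=> df; apply/funext => x; rewrite derive1E; have [_ ->] := df x.
Qed.

Lemma differentiable_uptoS n f f' :
  (forall x : R, is_derive x 1 f (f' x)) ->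
  differentiable_upto n f' -> differentiable_upto n.+1 f.
Proof.
by move=> df; rewrite -(is_derive_derive1 df); split => // x; have [] := df x.
Qed.

Lemma differentiable_uptoW n f :
  differentiable_upto n.+1 f -> differentiable_upto n f.
Proof. by elim: n f => // n IH f [df /IH]. Qed.

Lemma differentiable_upto_is_derive n f : differentiable_upto n.+1 f ->
  forall x : R, is_derive x 1 f (derive1 f x).
Proof. by move=> [df _] x; exact: derivable_is_derive1. Qed.

Lemma differentiable_uptoD n f g : differentiable_upto n f ->
  differentiable_upto n g -> differentiable_upto n (f \+ g).
Proof.
elim: n f g => // n IH f g Hf Hg.
apply: (@differentiable_uptoS _ _ (derive1 f \+ derive1 g)) => [x|].
  exact: (is_deriveD (differentiable_upto_is_derive Hf x)
                     (differentiable_upto_is_derive Hg x)).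
exact: IH (proj2 Hf) (proj2 Hg).
Qed.

Lemma differentiable_uptoM n f g : differentiable_upto n f ->
  differentiable_upto n g -> differentiable_upto n (f \* g).
Proof.
elim: n f g => // n IH f g Hf Hg.
apply: (@differentiable_uptoS _ _ ((f \* derive1 g) \+ (g \* derive1 f))).
  by move=> x; exact: (is_deriveM (differentiable_upto_is_derive Hf x)
                                  (differentiable_upto_is_derive Hg x)).
apply: differentiable_uptoD.
- exact: IH (differentiable_uptoW Hf) (proj2 Hg).
- exact: IH (differentiable_uptoW Hg) (proj2 Hf).
Qed.

Lemma differentiable_upto_comp n f g : differentiable_upto n f ->
  differentiable_upto n g -> differentiable_upto n (f \o g).
Proof.
elim: n f g => // n IH f g Hf Hg.
have h x := is_derive1_comp (differentiable_upto_is_derive Hf (g x))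
                            (differentiable_upto_is_derive Hg x).
apply: (differentiable_uptoS h).
have h' := IH _ _ (proj2 Hf) (differentiable_uptoW Hg).
exact: differentiable_uptoM h' (proj2 Hg).
Qed.

Lemma smooth_cst (c : R) : smooth (cst c).
Proof.
move=> n; elim: n c => // n IH c.
by apply: (@differentiable_uptoS _ _ (cst 0)) => // x; exact: is_derive_cst.
Qed.

Lemma smooth_id : smooth id.
Proof.
case=> // n; apply: (@differentiable_uptoS _ _ (cst 1)); exact: smooth_cst.
Qed.

(** The derivative of [1 / f] is [- (1 / f)^2 f'], in which [1 / f] occurs one order lower, so the
    induction hypothesis applies to it. *)
Lemma differentiable_uptoV n f : (forall x, f x != 0) ->
  differentiable_upto n f -> differentiable_upto n (fun x => (f x)^-1).
Proof.
move=> f0; elim: n => // n IH Hf.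
pose g x := (f x)^-1.
apply: (@differentiable_uptoS _ _ (g \* g \* (cst (-1) \* derive1 f))) => [x|].
  have := is_deriveV (f0 x) (differentiable_upto_is_derive Hf x).
  set u := _ *: _; suff -> : u = g x * g x * (-1 * derive1 f x) by [].
  by rewrite /u /g /GRing.scale/= -exprVn; ring.
have g_n : differentiable_upto n g by exact: IH (differentiable_uptoW Hf).
have g_g := differentiable_uptoM g_n g_n.
have f_n := differentiable_uptoM (@smooth_cst (-1) n) (proj2 Hf).
exact: differentiable_uptoM g_g f_n.
Qed.

Lemma smooth_derive1 f : smooth f -> smooth (derive1 f).
Proof. by move=> sf n; have [] := sf n.+1. Qed.

Lemma smooth_derivable f : smooth f -> forall x : R, derivable f x 1.
Proof. by move=> sf; have [] := sf 1%N. Qed.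

Lemma smooth_is_derive f : smooth f ->
  forall x : R, is_derive x 1 f (derive1 f x).
Proof. by move=> sf; exact: (differentiable_upto_is_derive (sf 1%N)). Qed.

Lemma smooth_continuous f : smooth f -> continuous f.
Proof.
move=> sf x; apply/differentiable_continuous/derivable1_diffP.
exact: smooth_derivable.
Qed.

Lemma smooth_affine (c d : R) : smooth (fun x => c * x + d).
Proof.
move=> n; have h := differentiable_uptoM (@smooth_cst c n) (@smooth_id n).
exact: differentiable_uptoD h (@smooth_cst d n).
Qed.

Lemma smoothB f g : smooth f -> smooth g -> smooth (f \- g).
Proof.
move=> sf sg n.
have -> : f \- g = f \+ (cst (-1) \* g).
  by apply/funext => x /=; rewrite mulN1r.
have h := differentiable_uptoM (@smooth_cst (-1) n) (sg n).
exact: differentiable_uptoD (sf n) h.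
Qed.

End Smooth.

(** * A smooth transition function from 0 to 1 *)

Section SmoothStep.
Context {R : realType}.
Implicit Types f g : R -> R.

(** A quadratic bound settles differentiability at 0 from both sides at once, which is how the
    junction point of [flat] is treated. *)
Lemma is_derive0_quadratic f (C : R) : f 0 = 0 ->
  (forall h, `|f h| <= C * h ^+ 2) -> is_derive (0 : R) 1 f 0.
Proof.
move=> f0 fC.
have fl : h^-1 *: (f (h *: 1 + 0) - f 0) @[h --> (0:R)^'] --> (0:R).
  apply/cvgr0Pnorm_le => e e0.
  have C1 : 0 < `|C| + 1 by rewrite ltr_wpDl.
  near=> h.
  have h0 : h != 0 by near: h; exact: nbhs_dnbhs_neq.
  rewrite f0 subr0 addr0 /GRing.scale/= mulr1 normrM normfV.
  rewrite ler_pdivrMl ?normr_gt0// (le_trans (fC h))//.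
  rewrite -(real_normK (num_real h)) expr2 mulrA mulrC ler_wpM2l//.
  apply: (@le_trans _ _ ((`|C| + 1) * `|h|)).
    by rewrite ler_wpM2r// (le_trans (ler_norm C))// lerDl.
  rewrite mulrC -ler_pdivlMr//; near: h.
  apply: dnbhs0_le; exact: divr_gt0.
apply: DeriveDef; first by apply/cvg_ex; exists 0.
exact/cvg_lim.
Unshelve. all: by end_near. Qed.

(* Multiplying by powers of [x^-1] makes the family stable under derivation. *)
Definition flat (n : nat) (x : R) : R :=
  if 0 < x then x^-1 ^+ n * expR (- x^-1) else 0.

Lemma flat_ge0 n x : 0 <= flat n x.
Proof.
rewrite /flat; case: ifPn => // x0.
by rewrite mulr_ge0 ?expR_ge0// exprn_ge0// invr_ge0 ltW.
Qed.

(** For [u = x^-1] the exponential series gives [u^(n+2) <= (n+2)! e^u]. Taking the exponent [n + 2]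
    rather than [n] leaves the factor [x^2] required by [is_derive0_quadratic]. *)
Lemma flat_le n x : flat n x <= (n.+2)`!%:R * x ^+ 2.
Proof.
rewrite /flat; case: ifPn => [x0|_]; last by rewrite mulr_ge0 ?sqr_ge0.
have u0 : 0 < x^-1 by rewrite invr_gt0.
rewrite expRN ler_pdivrMr ?expR_gt0//.
have := @expR_ge1Dxn R x^-1 n.+1 (ltW u0).
have f0 : 0 < (n.+2)`!%:R :> R by rewrite ltr0n fact_gt0.
move=> h.
have {}h : x^-1 ^+ n.+2 <= (n.+2)`!%:R * expR x^-1.
  by rewrite mulrC -ler_pdivrMr//; lra.
rewrite mulrAC -ler_pdivrMr ?exprn_gt0// (le_trans _ h)//.
by rewrite -exprVn -exprD addn2.
Qed.

Lemma is_derive_flat n (x : R) :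
  is_derive x 1 (flat n) (flat n.+2 x - n%:R * flat n.+1 x).
Proof.
have [x0|x0|->] := ltgtP x 0.
- have -> : flat n.+2 x - n%:R * flat n.+1 x = 0.
    by rewrite /flat ltNge (ltW x0)/= mulr0 subr0.
  have h : \near x, cst 0 x = flat n x.
    near=> y; rewrite /flat ifF//; apply/negbTE; rewrite -leNgt; apply/ltW.
    by near: y; exact: lt_nbhsl.
  exact: near_eq_is_derive h _.
- have h : \near x, ((fun u => u ^+ n * expR (- u)) \o (fun y => y^-1)) x
      = flat n x.
    by near=> y; rewrite /flat ifT//; near: y; exact: lt_nbhsr.
  apply: near_eq_is_derive h _.
  have hV := is_deriveV (lt0r_neq0 x0) (is_derive_id x (1:R)).
  have hX := is_deriveX n (is_derive_id x^-1 (1:R)).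
  have hN : is_derive x^-1 (1:R) (fun u : R => - u) (-1).
    exact: is_deriveNid.
  have hE := is_derive1_comp (is_derive_expR (- x^-1)) hN.
  have h := is_derive1_comp (is_deriveM hX hE) hV.
  have fE : (fun y : R => y^-1) = (fun y => (id y)^-1) by [].
  have gE : (fun u : R => u ^+ n * expR (- u)) = (id ^+ n) * (expR \o -%R).
    by apply/funext => u; rewrite !fctE.
  rewrite gE; apply: (is_derive_eq h).
  rewrite /flat x0 /GRing.scale/= !fctE.
  rewrite -exprVn; set E := expR (- x^-1); set u := x^-1.
  (* The derivative of [u ^+ n] carries the truncated predecessor of [n], hence the separate case
     [n = 0]. *)
  case: n {h hX gE} => [|n]/=; first by rewrite !expr0; ring.
  by rewrite !exprS; ring.
- have -> : flat n.+2 0 - n%:R * flat n.+1 0 = 0.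
    by rewrite /flat ltxx mulr0 subr0.
  apply: (@is_derive0_quadratic _ (n.+2)`!%:R); first by rewrite /flat ltxx.
  by move=> h; rewrite ger0_norm ?flat_ge0// flat_le.
Unshelve. all: by end_near. Qed.

Lemma smooth_flat n : smooth (flat n).
Proof.
move=> k; elim: k n => // k IH n.
apply: (differentiable_uptoS (is_derive_flat n)).
have h := differentiable_uptoM (@smooth_cst _ (- n%:R) k) (IH n.+1).
rewrite (_ : (fun x => _) = flat n.+2 \+ (cst (- n%:R) \* flat n.+1)).
  exact: differentiable_uptoD (IH n.+2) h.
by apply/funext => x/=; rewrite mulNr.
Qed.

Definition step (x : R) : R := flat 0 x / (flat 0 x + flat 0 (1 - x)).

Lemma step_den_neq0 x : flat 0 x + flat 0 (1 - x) != 0.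
Proof.
apply/lt0r_neq0; have [x0|x0] := ltP 0 x.
  by rewrite ltr_pwDl ?flat_ge0// /flat x0 expr0 mul1r expR_gt0.
rewrite ltr_wpDl ?flat_ge0// /flat ifT; last by lra.
by rewrite expr0 mul1r expR_gt0.
Qed.

Lemma smooth_step : smooth step.
Proof.
move=> n.
have h1 := differentiable_upto_comp (@smooth_flat 0 n) (@smooth_affine _ (-1) 1 n).
have h2 := differentiable_uptoD (@smooth_flat 0 n) h1.
have E x : (flat 0 \+ (flat 0 \o (fun x => -1 * x + 1))) x
    = flat 0 x + flat 0 (1 - x).
  by rewrite /= mulN1r addrC [1 - x]addrC addrC.
have h3 := differentiable_uptoV (fun x => _ : _ x != 0) h2.
have {}h3 := h3 (fun x => eq_ind_r (fun u => u != 0) (step_den_neq0 x) (E x)).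
have := differentiable_uptoM (@smooth_flat 0 n) h3.
by congr differentiable_upto; apply/funext => x/=; rewrite mulN1r (addrC _ 1).
Qed.

Lemma step_le0 x : x <= 0 -> step x = 0.
Proof. by move=> x0; rewrite /step {1}/flat ltNge x0 mul0r. Qed.

Lemma step_ge1 x : 1 <= x -> step x = 1.
Proof.
move=> x1; have := step_den_neq0 x; rewrite /step.
have -> : flat 0 (1 - x) = 0 by rewrite /flat ltNge subr_le0 x1.
by rewrite addr0 => /divff.
Qed.

Lemma step_ge0 x : 0 <= step x.
Proof. by rewrite divr_ge0 ?addr_ge0 ?flat_ge0. Qed.

Lemma step_le1 x : step x <= 1.
Proof.
have h := step_den_neq0 x.
rewrite ler_pdivrMr; last by rewrite lt_neqAle eq_sym h addr_ge0 ?flat_ge0.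
by rewrite mul1r lerDl flat_ge0.
Qed.

End SmoothStep.

(** * The scaling field on the Fourier side *)

Section FourierTestFunctions.
Local Open Scope complex_scope.
Context {R : realType}.
Implicit Types p q : R -> R.
Local Notation mu := (@lebesgue_measure R).

Lemma cabs_real (x : R) : cabs x%:C = `|x|.
Proof. by rewrite /cabs normc_def/= expr0n addr0 sqrtr_sqr. Qed.

Lemma cderive_real p : cderive (fun x => (p x)%:C) = fun x => (derive1 p x)%:C.
Proof.
apply/funext => x; rewrite /cderive/=; congr (_ +i* _).
exact: derive1_cst.
Qed.

Lemma cderiven_real k p :
  cderiven k (fun x => (p x)%:C) = fun x => (iter k (fun f : R -> R => derive1 f) p x)%:C.
Proof.
elim: k => // k IH.
by rewrite /cderiven iterS -[iter k _ _]/(cderiven k _) IH cderive_real.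
Qed.

(** The inequality is strict, so the condition lives on an open set and passes to derivatives with
    the same [M]. *)
Definition vanishes_outside (M : R) p := forall x, M < `|x| -> p x = 0.

Lemma vanishes_outside_derive1 M p :
  vanishes_outside M p -> vanishes_outside M (derive1 p).
Proof.
move=> pM x Mx.
have h : \near x, p x = cst 0 x.
  near=> y; apply: pM; near: y.
  apply: (cvgr_gt `|x|) => //; exact: norm_continuous.
by rewrite derive1E (near_eq_derive _ h) derive_cst.
Unshelve. all: by end_near. Qed.

Lemma smooth_iter_derive1 k p : smooth p -> smooth (iter k (fun f : R -> R => derive1 f) p).
Proof. by move=> sp; elim: k => //= k; exact: smooth_derive1. Qed.

Lemma vanishes_outside_iter_derive1 k M p :
  vanishes_outside M p -> vanishes_outside M (iter k (fun f : R -> R => derive1 f) p).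
Proof. by move=> pM; elim: k => //= k; exact: vanishes_outside_derive1. Qed.

Lemma smoothM p q : smooth p -> smooth q -> smooth (p \* q).
Proof. by move=> sp sq n; exact: differentiable_uptoM. Qed.

Lemma smooth_comp p q : smooth p -> smooth q -> smooth (p \o q).
Proof. by move=> sp sq n; exact: differentiable_upto_comp. Qed.

Lemma smooth_exprn j : smooth (fun x : R => x ^+ j).
Proof.
elim: j => [|j IH].
  rewrite (_ : (fun x => _) = cst 1); first exact: smooth_cst.
  by apply/funext => x; rewrite expr0.
rewrite (_ : (fun x => _) = (id \* (fun x => x ^+ j))).
  exact: smoothM (@smooth_id _) IH.
by apply/funext => x; rewrite exprS.
Qed.

Lemma smooth_vanishing_schwartz M p : smooth p -> vanishes_outside M p ->
  schwartz (fun x => (p x)%:C).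
Proof.
move=> sp pM k; rewrite cderiven_real.
have sq := smooth_iter_derive1 k sp.
have qM := vanishes_outside_iter_derive1 k pM.
set q := iter _ _ _ in sq qM *.
split=> [x|j].
  by split; [exact: smooth_derivable|exact: derivable_cst].
(* [M] may be negative; this choice gives a genuine segment containing the support in its
   interior. *)
pose K : R := `|M| + 1.
have K0 : - K <= K by rewrite -subr_ge0 opprK addr_ge0 ?addr_ge0.
have cq : {within `[- K, K], continuous (fun x => `|x| ^+ j * `|q x|)}.
  have sj := smoothM (smooth_exprn j) sq.
  rewrite (_ : (fun x => _) = (fun x => `|x ^+ j * q x|)); last first.
    by apply/funext => x; rewrite normrM normrX.
  apply: continuous_subspaceT => x.
  have h := smooth_continuous sj; have {}h := h x.
  by have := cvg_norm h; exact.
have [c _ hc] := EVT_max K0 cq.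
exists (`|c| ^+ j * `|q c|) => x; rewrite cabs_real.
have [xK|xK] := leP `|x| K.
  by apply: hc; rewrite in_itv/= -ler_norml.
rewrite (qM x) ?normr0 ?mulr0 ?mulr_ge0 ?exprn_ge0//.
by rewrite (le_lt_trans _ xK)// (le_trans (ler_norm M))// lerDl.
Qed.

Lemma smooth_cos_sin n :
  differentiable_upto n (@cos R) /\ differentiable_upto n (@sin R).
Proof.
elim: n => // n [IHc IHs]; split; last first.
  exact: differentiable_uptoS (@is_derive_sin R) IHc.
apply: differentiable_uptoS (@is_derive_cos R) _.
have := differentiable_uptoM (@smooth_cst _ (-1) n) IHs.
by congr differentiable_upto; apply/funext => x/=; rewrite mulN1r.
Qed.

Lemma smooth_integrable p (K : R) :
  smooth p -> mu.-integrable `[- K, K] (EFin \o p).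
Proof.
move=> sp; apply: continuous_compact_integrable; first exact: segment_compact.
by apply: continuous_subspaceT; exact: smooth_continuous.
Qed.

Lemma vanishes_outside_Rintegral M K p : M < K -> vanishes_outside M p ->
  \int[mu]_x p x = \int[mu]_(x in `[- K, K]) p x.
Proof.
move=> MK pM; rewrite [RHS]Rintegral_mkcond; congr (Rintegral _ _ _).
apply/funext => x; rewrite patchE; case: ifPn => //.
rewrite notin_setE/= in_itv/= -ler_norml => /negP; rewrite -ltNge => Kx.
by rewrite pM// (lt_trans MK).
Qed.

(** For real [p], the shifts [0] and [- (pi / 2)] give, up to [(2 pi)^-1], the real and the
    imaginary part of the Fourier transform, so each property is proved once for both. *)
Definition cosine_transform (theta : R) p (x : R) : R :=
  \int[mu]_xi (cos (- (x * xi) + theta) * p xi).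

(** Integration by parts without boundary terms, since [p] vanishes at both endpoints of [[- K, K]].
    The factor [x] is moved onto [p] before differentiating in [x]. *)
Lemma mulx_cosine_transform theta M p x : smooth p -> vanishes_outside M p ->
  x * cosine_transform theta p x =
  \int[mu]_xi (sin (- (x * xi) + theta) * derive1 p xi).
Proof.
move=> sp pM; pose K : R := `|M| + 1.
have MK : M < K by rewrite (le_lt_trans (ler_norm M))// ltrDl.
have K0 : - K < K by rewrite -subr_gt0 opprK addr_gt0// ltr_wpDl.
have phase : (fun xi => - (x * xi) + theta) = (fun xi => - x * xi + theta).
  by apply/funext => xi; rewrite mulNr.
have sphase : smooth (fun xi => - (x * xi) + theta).
  by rewrite phase; exact: smooth_affine.
have ssin : smooth (fun xi => sin (- (x * xi) + theta)).
  exact: smooth_comp (fun n => (smooth_cos_sin n).2) sphase.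
have scos : smooth (fun xi => cos (- (x * xi) + theta)).
  exact: smooth_comp (fun n => (smooth_cos_sin n).1) sphase.
have dsin : derive1 (fun xi => sin (- (x * xi) + theta)) =
    (fun xi => - x * cos (- (x * xi) + theta)).
  apply: is_derive_derive1 => xi.
  have h : is_derive xi 1 (fun xi => - (x * xi) + theta) (- x).
    rewrite phase; apply: is_derive_eq.
    by rewrite /GRing.scale/= mulr1 addr0.
  have := @is_derive1_comp R sin (fun xi => - (x * xi) + theta) xi _ _
    (is_derive_sin _) h.
  by rewrite mulrC.
rewrite /cosine_transform.
rewrite (@vanishes_outside_Rintegral M K)//; last first.
  by move=> y /pM ->; rewrite mulr0.
rewrite -RintegralZl//; last exact: smooth_integrable (smoothM scos sp).
rewrite (@vanishes_outside_Rintegral M K)//; last first.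
  by move=> y /(vanishes_outside_derive1 pM) ->; rewrite mulr0.
have LR q : smooth q -> derivable_oo_LRcontinuous q (- K) K.
  move=> sq; split => [y _||]; first exact: smooth_derivable.
  - by apply: cvg_at_right_filter; exact: smooth_continuous.
  - by apply: cvg_at_left_filter; exact: smooth_continuous.
have W q : smooth q -> {within `[- K, K], continuous q}.
  by move=> sq; apply: continuous_subspaceT; exact: smooth_continuous.
rewrite (@Rintegration_by_parts R (fun xi => sin (- (x * xi) + theta)) p
  (fun xi => - x * cos (- (x * xi) + theta)) (derive1 p))//.
- rewrite (pM K) ?(pM (- K)) ?normrN ?mulr0 ?ger0_norm ?addr_ge0//.
  rewrite subr0 sub0r -[RHS]mulN1r -RintegralZl//; last first.
    apply: (@smooth_integrable (fun y => - x * cos (- (x * y) + theta) * p y)).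
    by apply: smoothM sp; exact: smoothM (@smooth_cst _ (- x)) scos.
  by apply: eq_Rintegral => y _; rewrite !mulrA !mulN1r opprK.
- by apply: W; exact: smoothM (@smooth_cst _ (- x)) scos.
- exact: LR.
- by rewrite dsin.
- by apply: W; exact: smooth_derive1.
- exact: LR.
Qed.

(** Once [x] has been absorbed, the variable occurs only inside the sine. Differentiation under the
    integral is then dominated by [|z p'(z)|] on a fixed segment, independently of [x]. *)
Lemma is_derive_mulx_cosine_transform theta M p (x : R) : smooth p ->
  vanishes_outside M p ->
  is_derive x 1 (fun x => x * cosine_transform theta p x)
    (cosine_transform theta (fun xi => - xi * derive1 p xi) x).
Proof.
move=> sp pM; pose K : R := M + 1.
have MK : M < K by rewrite ltrDl.
have sq := smooth_derive1 sp.
have qM := vanishes_outside_derive1 pM.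
set q := derive1 p in sq qM *.
have -> : (fun x => x * cosine_transform theta p x) =
    (fun x => \int[mu]_(xi in `[- K, K]) (sin (- (x * xi) + theta) * q xi)).
  apply/funext => y; rewrite (mulx_cosine_transform _ _ sp pM) -/q.
  by rewrite (@vanishes_outside_Rintegral M K)// => z /qM ->; rewrite mulr0.
rewrite /cosine_transform.
rewrite (@vanishes_outside_Rintegral M K)//; last first.
  by move=> y /qM ->; rewrite !mulr0.
have sphase y : smooth (fun xi => - (y * xi) + theta).
  rewrite (_ : (fun xi => _) = (fun xi => - y * xi + theta)).
    exact: smooth_affine.
  by apply/funext => xi; rewrite mulNr.
have df (y z : R) : is_derive y 1 (fun y => sin (- (y * z) + theta) * q z)
    (cos (- (y * z) + theta) * (- z * q z)).
  have h : is_derive y 1 (fun y => - (y * z) + theta) (- z).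
    rewrite (_ : (fun xi => _) = (fun xi => - z * xi + theta)); last first.
      by apply/funext => xi; rewrite mulNr mulrC.
    by apply: is_derive_eq; rewrite /GRing.scale/= mulr1 addr0.
  have h2 := @is_derive1_comp R sin (fun y => - (y * z) + theta) y _ _
    (is_derive_sin _) h.
  have h3 := is_deriveM h2 (is_derive_cst (q z) y 1).
  by apply: (is_derive_eq h3); rewrite /GRing.scale/=; ring.
have xI : `]x - 1, x + 1[%classic x.
  by rewrite /= in_itv/=; apply/andP; split; lra.
pose f (y : R) (z : measurableTypeR R) := sin (- (y * z) + theta) * q z.
have intf (y : R) : `]x - 1, x + 1[%classic y ->
    mu.-integrable `[- K, K] (EFin \o f y).
  move=> _.
  apply: (@smooth_integrable (fun z => sin (- (y * z) + theta) * q z)).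
  by apply: smoothM sq; exact: smooth_comp (fun n => (smooth_cos_sin n).2) _.
have derf (y : R) (z : measurableTypeR R) : `]x - 1, x + 1[%classic y ->
    `[- K, K]%classic z -> derivable (f ^~ z) y 1.
  by move=> _ _; have [] := df y z.
have intG : mu.-integrable `[- K, K] (EFin \o (fun z => `|z * q z|)).
  have := smooth_integrable K (smoothM (@smooth_id _) sq).
  by move=> /integrable_norm; congr integrable.
have G_ub (y : R) (z : measurableTypeR R) : `]x - 1, x + 1[%classic y ->
    `[- K, K]%classic z -> `|partial1of2 f y z| <= `|z * q z|.
  move=> _ _; rewrite /partial1of2 derive1E; have [_ ->] := df y z.
  by rewrite normrM mulNr normrN ler_piMl// ler_norml cos_geN1 cos_le1.
have mK : measurable (`[- K, K] : set R) by [].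
have D := @derivable_under_integral R _ _ mu f _ mK _ _ _ xI intf derf
  _ (fun _ => normr_ge0 _) intG G_ub.
have E := @differentiation_under_integral R _ _ mu f _ mK _ _ _ xI intf derf
  _ (fun _ => normr_ge0 _) intG G_ub.
apply: DeriveDef; first exact: D.
rewrite -derive1E [LHS]E; apply: eq_Rintegral => z _.
by rewrite /partial1of2 derive1E; have [_ ->] := df x z.
Qed.

Lemma fourier_real p x : fourier (fun x => (p x)%:C) x =
  ((2 * pi)^-1 * cosine_transform 0 p x) +i*
  ((2 * pi)^-1 * cosine_transform (- (pi / 2)) p x).
Proof.
rewrite /fourier /cintegral /cosine_transform.
set A := (X in X +i* _); set B := (X in _ +i* X).
rewrite [LHS](_ : _ = ((2 * pi)^-1 * A) +i* ((2 * pi)^-1 * B)); last first.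
  by apply/eqP; rewrite eq_complex/= !mul0r subr0 addr0 !eqxx.
congr (_ * _ +i* (_ * _)); apply: eq_Rintegral => xi _ /=.
- by rewrite mulr0 subr0 addr0 (mulrC xi x).
- by rewrite mulr0 add0r cosBpihalf (mulrC xi x).
Qed.

(** Applied to a Fourier transform, the operations that [scaling_field] performs on its test
    function (multiplication by [x], then derivation) become the Euler operator on the frequency
    side. *)
Lemma cderive_mulx_fourier M p : smooth p -> vanishes_outside M p ->
  cderive (fun x => x%:C * fourier (fun xi => (p xi)%:C) x) =
  fourier (fun xi => (- xi * derive1 p xi)%:C).
Proof.
move=> sp pM; apply/funext => x.
rewrite (@fourier_real (fun xi => - xi * derive1 p xi)) /cderive.
pose c : R := (2 * pi)^-1.
have dF theta : derive1 (fun x => c * (x * cosine_transform theta p x)) x =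
    c * cosine_transform theta (fun xi => - xi * derive1 p xi) x.
  have h := is_derive_mulx_cosine_transform theta x sp pM.
  have h2 := is_deriveZ c h.
  by rewrite derive1E; have [_ E] := h2; exact: E.
pose F y := y%:C * fourier (fun xi => (p xi)%:C) y.
have -> : (fun y => complex.Re (F y)) =
    (fun y => c * (y * cosine_transform 0 p y)).
  by apply/funext => y; rewrite /F fourier_real/= mul0r subr0 mulrCA.
have -> : (fun y => complex.Im (F y)) =
    (fun y => c * (y * cosine_transform (- (pi / 2)) p y)).
  by apply/funext => y; rewrite /F fourier_real/= mul0r addr0 mulrCA.
by rewrite !dF.
Qed.

(** The two densities are compared on the single test function [fourier p]. The minus sign of
    [dist_derive] cancels the one in [- xi * derive1 p xi]. *)
Lemma scaling_field_density a T (f g : R -> R[i]) M p :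
  fourier_density T f -> fourier_density (scaling_field a T) g ->
  smooth p -> vanishes_outside M p ->
  cintegral setT (fun xi => g xi * (p xi)%:C) =
  (a^-1)%:C * cintegral setT (fun xi => f xi * (xi * derive1 p xi)%:C).
Proof.
move=> [_ Tf] [_ Tg] sp pM.
have spS := smooth_vanishing_schwartz sp pM.
have [_ <-] := Tg _ spS.
pose q xi := - xi * derive1 p xi.
have sq : smooth q.
  have h := smooth_affine (-1) 0; apply: smoothM (smooth_derive1 sp).
  by rewrite (_ : -%R = fun x => -1 * x + 0)//; apply/funext => x; ring.
have qM : vanishes_outside M q.
  by move=> x /(vanishes_outside_derive1 pM); rewrite /q => ->; rewrite mulr0.
have [qi qE] := Tf _ (smooth_vanishing_schwartz sq qM).
rewrite /scaling_field /dist_mulx /dist_derive (cderive_mulx_fourier sp pM) qE.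
congr (_ * _); rewrite /cintegral.
case: qi => qr qi.
apply/eqP; rewrite eq_complex/=; apply/andP; split; apply/eqP.
- rewrite -[LHS]mulN1r -RintegralZl//; apply: eq_Rintegral => xi _.
  by rewrite /q; case: (f xi) => u v /=; rewrite !mulr0; ring.
- rewrite -[LHS]mulN1r -RintegralZl//; apply: eq_Rintegral => xi _.
  by rewrite /q; case: (f xi) => u v /=; rewrite !mulr0; ring.
Qed.

End FourierTestFunctions.

(** * From the weak to the almost everywhere identity *)

Section WeakDerivative.
Context {R : realType}.
Local Notation mu := (@lebesgue_measure R).
Implicit Types f g h : R -> R.

Lemma locally_integrable_segment f (a b : R) : locally_integrable setT f ->
  mu.-integrable `[a, b] (EFin \o f).
Proof.
move=> [mf _ intf]; apply/integrableP; split.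
  by apply/measurable_EFinP; exact: measurable_funTS.
by apply: intf => //; exact: segment_compact.
Qed.

Lemma locally_integrable_mulx f : locally_integrable setT f ->
  locally_integrable setT (fun x => x * f x).
Proof.
move=> [mf _ intf]; split => //; first exact: measurable_funM.
  exact: openT.
move=> K KT cK; have [M [Mr MK]] := compact_bounded cK.
pose B : R := `|M| + 1.
have BK x : K x -> `|x| <= B.
  by apply: (MK B); rewrite (le_lt_trans (ler_norm M))// ltrDl.
have B0 : 0 <= B by rewrite addr_ge0.
have mK := compact_measurable cK.
have mfK : measurable_fun K (fun x => `|f x|%:E).
  by apply/measurable_EFinP; apply: measurableT_comp => //; exact: measurable_funTS.
apply: (@le_lt_trans _ _ (\int[mu]_(x in K) (B%:E * `|f x|%:E))%E).
  apply: ge0_le_integral => //.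
  - apply/measurable_EFinP; apply: measurableT_comp => //.
    by apply: measurable_funTS; exact: measurable_funM.
  - by apply: emeasurable_funM.
  - by move=> x Kx; rewrite -EFinM lee_fin normrM ler_wpM2r// BK.
by rewrite ge0_integralZl//= lte_mul_pinfty// intf.
Qed.

Lemma derive1_step_outside (x : R) : (x < 0) || (1 < x) -> derive1 step x = 0.
Proof.
case/orP => hx.
- have h : \near x, step x = cst 0 x.
    by near=> y; apply: step_le0; apply/ltW; near: y; exact: lt_nbhsl.
  by rewrite derive1E (near_eq_derive _ h) derive_cst.
- have h : \near x, step x = cst 1 x.
    by near=> y; apply: step_ge1; apply/ltW; near: y; exact: lt_nbhsr.
  by rewrite derive1E (near_eq_derive _ h) derive_cst.
Unshelve. all: by end_near. Qed.

Lemma derive1_step_bounded :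
  exists2 B : R, 0 < B & forall x : R, `|derive1 step x| <= B.
Proof.
have ss := smooth_derive1 (@smooth_step R).
have c1 : {within `[0, 1], continuous (fun x : R => `|derive1 step x|)}.
  apply: continuous_subspaceT => x.
  have h := smooth_continuous ss; have {}h := h x.
  by have := cvg_norm h; exact.
have [c _ hc] := EVT_max ler01 c1.
(* The added 1 makes the bound strictly positive, so that one may divide by it. *)
exists (`|derive1 step c| + 1); first by rewrite ltr_wpDl.
move=> x; have [hx|] := boolP ((x < 0) || (1 < x)).
  by rewrite (derive1_step_outside hx) normr0 addr_ge0.
rewrite negb_or -!leNgt => hx; rewrite (le_trans (hc x _)) ?lerDl//.
Qed.

Lemma is_derive_step_affine (N b x : R) :
  is_derive x 1 (fun y => step (N * (y - b))) (N * derive1 step (N * (x - b))).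
Proof.
have h : is_derive x 1 (fun y => N * (y - b)) N.
  rewrite (_ : (fun y => _) = (fun y => N * y - N * b)); last first.
    by apply/funext => y; rewrite mulrBr.
  by apply: is_derive_eq; rewrite /GRing.scale/= mulr1 oppr0 addr0.
have := @is_derive1_comp R step (fun y => N * (y - b)) x _ _
  (smooth_is_derive (@smooth_step R) _) h.
by rewrite mulrC.
Qed.

Lemma smooth_step_affine (N b : R) : smooth (fun y => step (N * (y - b))).
Proof.
have := smooth_comp (@smooth_step R) (@smooth_affine R N (- (N * b))).
by congr smooth; apply/funext => y /=; rewrite mulrBr.
Qed.

Lemma smooth_measurable f : smooth f -> measurable_fun setT f.
Proof. by move=> sf; exact: continuous_measurable_fun (smooth_continuous sf). Qed.

Lemma Rintegral_support f (A : set R) : (forall x, ~ A x -> f x = 0) ->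
  \int[mu]_x f x = \int[mu]_(x in A) f x.
Proof.
move=> fA; rewrite [RHS]Rintegral_mkcond; congr (Rintegral _ _ _).
apply/funext => x; rewrite patchE; case: ifPn => //.
by rewrite notin_setE => /fA.
Qed.

Lemma dominated_Rcvg (D : set R) (mD : measurable D) (f_ : (R -> R)^nat)
    (f G : R -> R) :
  (forall n, measurable_fun D (f_ n)) ->
  (forall x, D x -> f_ n x @[n --> \oo] --> f x) ->
  mu.-integrable D (EFin \o G) ->
  (forall n x, D x -> `|f_ n x| <= G x) ->
  \int[mu]_(x in D) f_ n x @[n --> \oo] --> \int[mu]_(x in D) f x.
Proof.
move=> mf ff iG fG.
have mfE n : measurable_fun D (EFin \o f_ n) by exact/measurable_EFinP.
have ffE x : D x -> (EFin \o f_ n) x @[n --> \oo] --> (EFin \o f) x.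
  by move=> Dx; apply: cvg_EFin; [exact: nearW|exact: ff].
have fGE n x : D x -> (`|(EFin \o f_ n) x| <= (EFin \o G) x)%E.
  by move=> Dx; rewrite lee_fin fG.
have h := @dominated_cvg _ _ _ mu D mD (fun n => EFin \o f_ n) (EFin \o f)
  (EFin \o G) mfE ffE (fun x _ => isT) iG fGE.
apply: fine_cvg; rewrite fineK//.
have fi : mu.-integrable D (EFin \o f).
  have mfl : measurable_fun D (EFin \o f).
    by apply: emeasurable_fun_cvg ffE.
  apply: le_integrable iG => // x Dx /=; rewrite lee_fin.
  have /(_ _)/cvg_lim <-// := cvg_norm (ff x Dx).
  rewrite (le_trans _ (ler_norm _))//.
  apply: limr_le; last by apply: nearW => n; exact: fG.
  by apply: is_cvg_norm; apply/cvg_ex; exists (f x); exact: ff.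
exact: integrable_fin_num.
Qed.

Lemma integrable_mul_bounded (D : set R) f (k : R -> R) (c : R) :
  measurable D -> mu.-integrable D (EFin \o f) -> measurable_fun D k ->
  (forall x, D x -> `|k x| <= c) ->
  mu.-integrable D (EFin \o (fun x => f x * k x)).
Proof.
move=> mD fi mk kc; have := @integrableMl _ _ _ mu D mD _ k fi mk.
apply; exists c; split; first exact: num_real.
by move=> b cb x Dx; exact: le_trans (kc x Dx) (ltW cb).
Qed.

Lemma le_normr_Rintegral_bound (D : set R) f (k : R -> R) (c : R) : 0 <= c ->
  measurable D -> mu.-integrable D (EFin \o f) -> measurable_fun D k ->
  (forall x, D x -> `|k x| <= c) ->
  (`|\int[mu]_(x in D) (f x * k x)|%:E <=
    c%:E * \int[mu]_(x in D) `|f x|%:E)%E.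
Proof.
move=> c0 mD fi mk kc.
have mf : measurable_fun D f by apply/measurable_EFinP; exact: measurable_int fi.
have fki := integrable_mul_bounded mD fi mk kc.
have mfk := measurable_int _ fki.
rewrite EFin_normr_Rintegral// (le_trans (le_abse_integral _ _ _))//.
have mnf : measurable_fun D (fun x => `|f x|%:E).
  by apply/measurable_EFinP; exact: measurableT_comp.
rewrite -ge0_integralZl//; apply: ge0_le_integral => //.
- exact: measurableT_comp.
- exact: emeasurable_funM.
- by move=> x Dx; rewrite /= -EFinM lee_fin normrM mulrC ler_wpM2r// kc.
Qed.

(** The derivative of [step (N * (x - b))]: it has total mass 1 and lives on [[b, b + N^-1]], hence
    is a one-sided approximate identity at [b]. *)
Definition bump (N b x : R) : R := N * derive1 step (N * (x - b)).

Lemma bump_outside (N b x : R) : 0 < N -> (x < b) || (b + N^-1 < x) ->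
  bump N b x = 0.
Proof.
move=> N0 hx; rewrite /bump derive1_step_outside ?mulr0//.
case/orP : hx => hx; apply/orP; [left|right].
  by rewrite pmulr_rlt0// subr_lt0.
by rewrite mulrC -ltr_pdivrMr// mul1r ltrBrDl.
Qed.

Lemma smooth_bump (N b : R) : smooth (bump N b).
Proof.
have h := is_derive_derive1 (is_derive_step_affine N b).
by have := smooth_derive1 (smooth_step_affine N b); rewrite h.
Qed.

Lemma Rintegral_bump (N b c : R) : 0 < N -> b + N^-1 < c ->
  \int[mu]_(x in `[b, c]) bump N b x = 1.
Proof.
move=> N0 bc; have {}bc' : b < c by rewrite (le_lt_trans _ bc)// lerDl invr_ge0 ltW.
have sS := smooth_step_affine N b.
rewrite /Rintegral (@continuous_FTC2 R _ (fun y => step (N * (y - b))))//.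
- rewrite subrr mulr0 (step_le0 (lexx _)) step_ge1 ?sube0//.
  by rewrite mulrC -ler_pdivrMr// mul1r lerBrDl ltW.
- by apply: continuous_subspaceT; exact: smooth_continuous (smooth_bump N b).
- split => [y _||]; first exact: smooth_derivable sS y.
  + by apply: cvg_at_right_filter; exact: smooth_continuous sS _.
  + by apply: cvg_at_left_filter; exact: smooth_continuous sS _.
- by move=> x _; rewrite (is_derive_derive1 (is_derive_step_affine N b)).
Qed.

(** Since the bump has mass 1, the error is the integral of [(h - h(b))] against it. The bump is at
    most [N B] in absolute value on an interval of length of order [1 / N], so this error is
    controlled by a mean of [|h - h(b)|] over a small ball around [b], which tends to 0 at a
    Lebesgue point. *)
Lemma cvg_Rintegral_bump h (b : R) : locally_integrable setT h ->
  lebesgue_pt h b ->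
  \int[mu]_x (h x * bump n.+1%:R b x) @[n --> \oo] --> h b.
Proof.
move=> lh hb; have [B B0 hB] := derive1_step_bounded.
have [] := (fine_cvgP (fun r : R => davg h b r) 0).1 hb.
move=> dfin /cvgr0Pnorm_lt dlt; apply/cvgrPdist_le => e e0.
have e60 : 0 < e / (6 * B) by rewrite divr_gt0// mulr_gt0.
have [d1 /= d10 {}dfin] := dfin.
have [d2 /= d20 {}dlt] := dlt _ e60.
have d130 : 0 < d1 / 3 by rewrite divr_gt0.
have d230 : 0 < d2 / 3 by rewrite divr_gt0.
near=> n.
have n1 : n.+1%:R^-1 < d1 / 3.
  by near: n; exact: (near_infty_natSinv_lt (PosNum d130)).
have n2 : n.+1%:R^-1 < d2 / 3.
  by near: n; exact: (near_infty_natSinv_lt (PosNum d230)).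
pose N : R := n.+1%:R; rewrite -/N in n1 n2 *.
have N0 : 0 < N by rewrite ltr0n.
(* The segment [[b, b + 2 / N]] strictly exceeds the support of the bump, as [Rintegral_bump] asks,
   and the open ball of radius [3 / N] contains that segment. The ball has measure [6 / N], whence
   the factor [6 * B] dividing [e]. *)
pose r : R := 3 * N^-1.
have r0 : 0 < r by rewrite mulr_gt0// invr_gt0.
have V0 : 0 < N^-1 by rewrite invr_gt0.
have rd1 : ball_ Num.norm (0 : R) d1 r.
  by rewrite /= sub0r normrN gtr0_norm// /r mulrC -ltr_pdivlMr.
have rd2 : ball_ Num.norm (0 : R) d2 r.
  by rewrite /= sub0r normrN gtr0_norm// /r mulrC -ltr_pdivlMr.
have df := dfin r rd1 r0.
have dl := dlt r rd2 r0.
pose I := `[b, b + 2 * N^-1]%classic.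
rewrite (@Rintegral_support _ I); last first.
  move=> x /negP; rewrite /I/= in_itv/= negb_and -!ltNge => hx.
  rewrite bump_outside ?mulr0//; case/orP : hx => hx; apply/orP; [by left|right].
  by rewrite (lt_trans _ hx)// ltrD2l ltr_pMl// ltr1n.
have mI : measurable I by exact: measurable_itv.
have hi := locally_integrable_segment b (b + 2 * N^-1) lh.
have ci : mu.-integrable I (EFin \o (fun=> h b)).
  apply: continuous_compact_integrable; first exact: segment_compact.
  by apply: continuous_subspaceT => x; exact: cvg_cst.
have mk : measurable_fun I (bump N b).
  by apply: measurable_funTS; exact: smooth_measurable (smooth_bump N b).
have kB x : I x -> `|bump N b x| <= N * B.
  by move=> _; rewrite /bump normrM gtr0_norm// ler_pM2l.
have b1 : b + N^-1 < b + 2 * N^-1 by rewrite ltrD2l ltr_pMl// ltr1n.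
have bi : mu.-integrable I (EFin \o bump N b).
  apply: continuous_compact_integrable; first exact: segment_compact.
  apply: continuous_subspaceT; exact: smooth_continuous (smooth_bump N b).
have hki := integrable_mul_bounded mI hi mk kB.
have cki := integrable_mul_bounded mI ci mk kB.
have -> : h b = \int[mu]_(x in I) (h b * bump N b x).
  by rewrite RintegralZl// (Rintegral_bump N0 b1) mulr1.
rewrite distrC -RintegralB//.
under eq_Rintegral do rewrite -mulrBl.
have hci : mu.-integrable I (EFin \o (fun x => h x - h b)).
  have := @integrableB _ _ _ mu I mI _ _ hi ci.
  by congr integrable.
rewrite -lee_fin.
have NB0 : 0 <= N * B by rewrite mulr_ge0// ltW.
apply: (le_trans (le_normr_Rintegral_bound NB0 mI hci mk kB)).
have mbr : measurable (ball b r : set R) by exact: measurable_ball.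
have [mh _ _] := lh.
have mhb : measurable_fun setT (fun x => `|h x - h b|%:E).
  apply/measurable_EFinP; apply: measurableT_comp => //.
  exact: measurable_funB.
apply: (@le_trans _ _ ((N * B)%:E * \int[mu]_(x in ball b r) `|h x - h b|%:E)%E).
  rewrite lee_wpmul2l ?lee_fin//; apply: ge0_subset_integral => //.
    exact: measurable_funTS.
  move=> x; rewrite /I /ball/= in_itv/= => /andP[bx xb].
  rewrite distrC ger0_norm ?subr_ge0//.
  by rewrite ltrBlDl (le_lt_trans xb)// ltrD2l /r ltr_pM2r// ltr_nat.
have E : (\int[mu]_(x in ball b r) `|h x - h b|%:E =
    (r *+ 2)%:E * davg h b r)%E.
  rewrite /davg /iavg (lebesgue_measure_ball _ (ltW r0)) inver.
  rewrite muleA ifF; last by apply/negbTE; rewrite mulrn_eq0/= gt_eqF.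
  by rewrite -EFinM divff ?mul1e// mulrn_eq0/= gt_eqF.
rewrite E -(fineK df) -!EFinM lee_fin.
have := dl; rewrite /= ger0_norm ?fine_ge0 ?davg_ge0//.
move=> /ltW; rewrite ler_pdivlMr ?mulr_gt0//; apply: le_trans.
have -> : N * B * (r *+ 2 * fine (davg h b r)) =
  (N * N^-1) * (fine (davg h b r) * (6 * B)) by rewrite /r; ring.
by rewrite divff ?mul1r// gt_eqF.
Unshelve. all: by end_near. Qed.

(** This removes the constant of integration at the origin. As 0 cannot be assumed to be a Lebesgue
    point, the factor [x] is kept with the bump: [x N] is at most 1 on its support, so [B |f|]
    dominates, while the integrand is eventually zero at each point. *)
Lemma cvg_Rintegral_mulx_bump f : locally_integrable setT f ->
  \int[mu]_x (f x * (x * bump n.+1%:R 0 x)) @[n --> \oo] --> (0 : R).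
Proof.
move=> lf; have [B B0 hB] := derive1_step_bounded.
have fi := locally_integrable_segment 0 1 lf.
have [mf _ _] := lf.
have E n : \int[mu]_x (f x * (x * bump n.+1%:R 0 x)) =
    \int[mu]_(x in `[0, 1]) (f x * (x * bump n.+1%:R 0 x)).
  apply: Rintegral_support => x /negP; rewrite /= in_itv/= negb_and -!ltNge.
  move=> hx; rewrite bump_outside ?mulr0//.
  case/orP : hx => hx; apply/orP; [by left|right].
  by rewrite add0r (le_lt_trans _ hx)// invf_le1// ler1n.
under eq_cvg do rewrite E.
suff : \int[mu]_(x in `[0, 1]) (f x * (x * bump n.+1%:R 0 x)) @[n --> \oo]
    --> \int[mu]_(x in `[0, 1]) (cst 0 x) by rewrite Rintegral_cst// mul0r.
apply: (@dominated_Rcvg _ _ _ _ (fun x => `|f x| * B)) => //.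
- move=> n; apply: measurable_funTS; apply: measurable_funM => //.
  by apply: measurable_funM => //; exact: smooth_measurable (smooth_bump _ _).
- move=> x; rewrite /= in_itv/= => /andP[x0 x1].
  apply: cvg_near_cst.
  have [->|xn0] := eqVneq x 0; first by apply: nearW => n; rewrite mul0r mulr0.
  have {}x0 : 0 < x by rewrite lt_neqAle eq_sym xn0.
  near=> n; rewrite bump_outside ?mulr0// add0r; apply/orP; right.
  by near: n; exact: (near_infty_natSinv_lt (PosNum x0)).
- have := integrable_mul_bounded (k := cst B) (c := B) _ (integrable_norm fi).
  by apply => // x _; rewrite ger0_norm// ltW.
- move=> n x _; rewrite normrM ler_wpM2l//.
  have N0 : 0 < n.+1%:R :> R by rewrite ltr0n.
  have [hx|] := boolP ((x < 0) || (0 + n.+1%:R^-1 < x)).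
    by rewrite bump_outside// mulr0 normr0 ltW.
  rewrite negb_or -!leNgt add0r => /andP[x0 x1].
  rewrite /bump mulrA normrM -[leRHS]mul1r ler_pM//.
  rewrite ger0_norm ?mulr_ge0//.
  by rewrite -ler_pdivlMr// mul1r.
Unshelve. all: by end_near. Qed.

(** A smooth approximation of the indicator of []0, b]], whose derivative is the bump at 0 minus the
    bump at [b]. The form [x - 0] lets [is_derive_step_affine] serve for both terms. *)
Definition plateau (N b x : R) : R := step (N * (x - 0)) - step (N * (x - b)).

Lemma cvg_Rintegral_plateau g (b : R) : 0 < b -> locally_integrable setT g ->
  \int[mu]_x (g x * plateau n.+1%:R b x) @[n --> \oo] -->
  \int[mu]_(x in `[0, b]) g x.
Proof.
move=> b0 lg; have [mg _ _] := lg.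
have gi := locally_integrable_segment 0 (b + 1) lg.
have E n : \int[mu]_x (g x * plateau n.+1%:R b x) =
    \int[mu]_(x in `[0, b + 1]) (g x * plateau n.+1%:R b x).
  have N0 : 0 < n.+1%:R :> R by rewrite ltr0n.
  have N1 : 1 <= n.+1%:R :> R by rewrite ler1n.
  apply: Rintegral_support => x /negP; rewrite /= in_itv/= negb_and -!ltNge.
  move=> /orP[x0|xb]; rewrite /plateau subr0.
    rewrite !step_le0 ?subrr ?mulr0//; rewrite pmulr_rle0//; lra.
  by rewrite !step_ge1 ?subrr ?mulr0//; nra.
under eq_cvg do rewrite E.
(* At 0 both steps vanish, while at [b] only the second one does: the pointwise limit is the
   indicator of the interval open at 0 and closed at [b]. *)
have -> : \int[mu]_(x in `[0, b]) g x =
    \int[mu]_(x in `[0, b + 1]) (g \_ `]0, b]) x.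
  have gib := locally_integrable_segment 0 b lg.
  rewrite -Rintegral_itv_obnd_cbnd; last first.
    by apply: integrableS gib => //; exact: subset_itv_oc_cc.
  rewrite -Rintegral_mkcondr; congr (Rintegral _ _ _).
  apply/seteqP; split => x /=; rewrite !in_itv/=.
    move=> /andP[x0 xb]; by rewrite x0 xb (ltW x0) (le_trans xb) ?lerDl.
  by case.
apply: (@dominated_Rcvg _ _ _ _ (fun x => `|g x|)) => //.
- move=> n; apply: measurable_funTS; apply: measurable_funM => //.
  by apply: measurable_funB; apply: smooth_measurable; exact: smooth_step_affine.
- move=> x; rewrite /= in_itv/= => /andP[x0 x1].
  apply: cvg_near_cst; rewrite patchE.
  have [->|xn0] := eqVneq x 0.
    rewrite ifF; last by apply/negP; rewrite inE/= in_itv/= ltxx.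
    apply: nearW => n; rewrite /plateau !sub0r oppr0 !step_le0 ?subrr ?mulr0//.
    by rewrite mulrN oppr_le0 mulr_ge0// ltW.
  have {}x0 : 0 < x by rewrite lt_neqAle eq_sym xn0.
  have [xb|bx] := leP x b.
    rewrite ifT; last by rewrite inE/= in_itv/= x0.
    near=> n; rewrite /plateau subr0 step_ge1; last first.
      rewrite -ler_pdivrMl// mulr1; apply: ltW.
      by near: n; exact: (near_infty_natSinv_lt (PosNum x0)).
    by rewrite step_le0 ?subr0 ?mulr1// pmulr_rle0// subr_le0.
  rewrite ifF; last by apply/negP; rewrite inE/= in_itv/= x0/= leNgt bx.
  have xb0 : 0 < x - b by rewrite subr_gt0.
  near=> n; rewrite /plateau subr0 !step_ge1 ?subrr ?mulr0//.
    rewrite -ler_pdivrMl// mulr1; apply: ltW.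
    by near: n; exact: (near_infty_natSinv_lt (PosNum xb0)).
  rewrite -ler_pdivrMl// mulr1; apply: ltW.
  by near: n; exact: (near_infty_natSinv_lt (PosNum x0)).
- exact: integrable_norm.
- move=> n x _; rewrite normrM ler_piMr// /plateau ler_norml.
  have := step_le1 (n.+1%:R * (x - 0)); have := step_ge0 (n.+1%:R * (x - 0)).
  have := step_le1 (n.+1%:R * (x - b)); have := step_ge0 (n.+1%:R * (x - b)).
  by lra.
Unshelve. all: by end_near. Qed.

(* The weak form of [(x f)' = - a g]. *)
Definition weak_euler (a : R) f g := forall M p, smooth p ->
  vanishes_outside M p ->
  \int[mu]_x (g x * p x) = a^-1 * \int[mu]_x (f x * (x * derive1 p x)).

(** Test the weak identity with [plateau]. The side of [g] tends to its integral over [[0, b]]; on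
    the side of [f] the bump at 0 contributes nothing in the limit, and the bump at [b] recovers
    [b f(b)] at Lebesgue points of [x f(x)]. *)
Lemma weak_euler_ae (a : R) f g : a != 0 -> locally_integrable setT f ->
  locally_integrable setT g -> weak_euler a f g ->
  {ae mu, forall b : R, 0 < b -> b * f b = - a * \int[mu]_(x in `[0, b]) g x}.
Proof.
move=> a0 lf lg fg.
have := lebesgue_differentiation (locally_integrable_mulx lf).
apply: filterS; first exact: (ae_filter_ringOfSetsType mu).
move=> b hb b0.
have h1 := cvg_Rintegral_bump (locally_integrable_mulx lf) hb.
have h0 := cvg_Rintegral_mulx_bump lf.
have hp := cvg_Rintegral_plateau b0 lg.
have E n : a * \int[mu]_x (g x * plateau n.+1%:R b x) =
    \int[mu]_x (f x * (x * bump n.+1%:R 0 x)) -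
    \int[mu]_x (x * f x * bump n.+1%:R b x).
  have N0 : 0 < n.+1%:R :> R by rewrite ltr0n.
  have N1 : 1 <= n.+1%:R :> R by rewrite ler1n.
  pose N : R := n.+1%:R; rewrite -/N in N0 N1 *.
  have V0 : 0 < N^-1 by rewrite invr_gt0.
  have sp : smooth (plateau N b).
    exact: smoothB (smooth_step_affine N 0) (smooth_step_affine N b).
  have pM : vanishes_outside (b + 1) (plateau N b).
    move=> x hx; have [x0|x0] := leP 0 x.
      rewrite ger0_norm// in hx.
      by rewrite /plateau !step_ge1 ?subrr//; nra.
    by rewrite /plateau !step_le0 ?subrr//; nra.
  rewrite (fg _ _ sp pM) mulrA divff// mul1r.
  have dp : derive1 (plateau N b) = bump N 0 \- bump N b.
    apply: is_derive_derive1 => x.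
    exact: (is_deriveB (is_derive_step_affine N 0 x)
                       (is_derive_step_affine N b x)).
  have bi c : 0 <= c ->
      mu.-integrable setT (EFin \o (fun x => x * f x * bump N c x)).
    move=> c0; have [B B0 hB] := derive1_step_bounded.
    have hi := locally_integrable_segment c (c + N^-1) (locally_integrable_mulx lf).
    have mb : measurable_fun `[c, c + N^-1] (bump N c).
      by apply: measurable_funTS; exact: smooth_measurable (smooth_bump N c).
    have bB x : `[c, c + N^-1]%classic x -> `|bump N c x| <= N * B.
      by move=> _; rewrite /bump normrM gtr0_norm// ler_pM2l.
    have := integrable_mul_bounded _ hi mb bB.
    move=> /(_ _)/integrable_mkcond => /(_ _ _)/=.
    rewrite (_ : _ \_ _ = EFin \o (fun x => x * f x * bump N c x)); first exact.
    apply/funext => x; rewrite patchE; case: ifPn => //.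
    rewrite notin_setE/= in_itv/= => /negP; rewrite negb_and -!ltNge => hx.
    by rewrite bump_outside// mulr0.
  rewrite -RintegralB//; last 2 first.
  - have := bi 0 (lexx _); congr integrable; apply/funext => x /=.
    by rewrite (mulrC x) mulrA.
  - exact: bi (ltW b0).
  apply: eq_Rintegral => x _; rewrite dp /= !mulrBr; congr (_ - _).
  by rewrite mulrA (mulrC (f x)).
have L := cvgM (cvg_cst a) hp.
have {}L : \int[mu]_x (f x * (x * bump n.+1%:R 0 x)) -
    \int[mu]_x (x * f x * bump n.+1%:R b x) @[n --> \oo] -->
    a * \int[mu]_(x in `[0, b]) g x.
  by under eq_cvg do rewrite -E; exact: L.
have U := cvg_unique _ L (cvgB h0 h1).
by rewrite mulNr U// sub0r opprK.
Qed.

End WeakDerivative.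

Ltac pos :=
  lazymatch goal with
  | |- is_true (0 < _ * _)%R => first [assumption | apply: mulr_gt0; pos]
  | |- is_true (0 < _^-1)%R => rewrite invr_gt0; pos
  | |- is_true (0 < _ `^ _)%R => apply: powR_gt0; pos
  | |- is_true (0 < _ ^+ _)%R => apply: exprn_gt0; pos
  | |- is_true (0 < _ + _)%R =>
      first [assumption | apply: ltr_pwDl; pos | apply: ltr_wpDl; pos]
  | |- is_true (0 < _)%R => by []
  | |- is_true (0 <= `|_|)%R => exact: normr_ge0
  | |- is_true (0 <= _ `^ _)%R => exact: powR_ge0
  | |- is_true (0 <= _ ^+ 2)%R => exact: sqr_ge0
  | |- is_true (0 <= _ * _)%R =>
      first [assumption | apply: mulr_ge0; pos | apply: ltW; pos]
  | |- is_true (0 <= _ + _)%R =>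
      first [assumption | apply: addr_ge0; pos | apply: ltW; pos]
  | |- is_true (0 <= _^-1)%R => rewrite invr_ge0; pos
  | |- is_true (0 <= _)%R => first [by [] | apply: ltW; pos]
  end.

(** * Oscillatory kernels *)

Section OscillatoryIntegral.
Context {R : realType}.
Local Notation mu := (@lebesgue_measure R).
Implicit Types a x t theta p q y : R.

Lemma powR_invl (z b : R) : 0 <= z -> z^-1 `^ b = z `^ (- b).
Proof. by move=> z0; rewrite -powR_inv1// -powRrM mulN1r. Qed.

Lemma powR_div (y z b : R) : 0 <= y -> 0 <= z -> (y / z) `^ b = y `^ b / z `^ b.
Proof.
by move=> y0 z0; rewrite powRM ?invr_ge0// -powR_inv1// -powRrM mulN1r powRN.
Qed.

(** Inversion preserves the range of [z] and changes the sign of [b], which reduces everything to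
    the monotone case [0 <= b]. *)
Lemma powR_dyadic_bounds (z b : R) : 2^-1 <= z <= 2 ->
  2 `^ (- `|b|) <= z `^ b <= 2 `^ `|b|.
Proof.
wlog b0 : z b / 0 <= b => [wl|] /andP[z1 z2].
  have z0 : 0 < z by rewrite (lt_le_trans _ z1).
  have [b0|b0] := leP 0 b; first by apply: wl; rewrite ?z1.
  have := wl z^-1 (- b); rewrite oppr_ge0 (ltW b0) normrN => /(_ isT).
  rewrite powR_invl ?(ltW z0)// opprK; apply.
  rewrite lef_pV2 ?posrE// z2/=.
  by rewrite -[leRHS]invrK lef_pV2 ?posrE// invr_gt0.
have z0 : 0 < z by rewrite (lt_le_trans _ z1).
rewrite ger0_norm//; apply/andP; split; last first.
  by apply: ge0_ler_powR; rewrite ?nnegrE// ltW.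
rewrite -powR_invl//.
by apply: ge0_ler_powR; rewrite ?nnegrE// ltW.
Qed.

(** Used with [z = v / y] to keep the phase derivative away from 0 off the dyadic block of [v].
    After reduction to [0 <= b], the case [2 <= z] gives [2^b - 1], which is compared with
    [1 - 2^(- b)] through [u + u^-1 >= 2]. *)
Lemma powR_gap (z b : R) : 0 < z -> (z <= 2^-1) || (2 <= z) ->
  1 - 2 `^ (- `|b|) <= `|1 - z `^ b|.
Proof.
wlog b0 : z b / 0 <= b => [wl|] z0 zP.
  have [b0|b0] := leP 0 b; first exact: wl.
  have := wl z^-1 (- b); rewrite oppr_ge0 (ltW b0) normrN => /(_ isT).
  rewrite powR_invl ?(ltW z0)// opprK; apply.
    by rewrite invr_gt0.
  case/orP : zP => h; apply/orP; [right|left].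
    by rewrite -[leLHS]invrK lef_pV2 ?posrE// invr_gt0.
  by rewrite lef_pV2 ?posrE.
rewrite ger0_norm//.
have E : 2 `^ (- b) = 2^-1 `^ b :> R by rewrite powR_invl.
case/orP : zP => h.
- apply: le_trans (ler_norm _); rewrite lerD2l lerN2 E.
  by apply: ge0_ler_powR; rewrite ?nnegrE// ltW.
- rewrite distrC; apply: le_trans (ler_norm _).
  have h2 : 2 `^ b <= z `^ b by apply: ge0_ler_powR; rewrite ?nnegrE// ltW.
  have p0 : 0 < 2 `^ b :> R by exact: powR_gt0.
  apply: le_trans (_ : 2 `^ b - 1 <= _); last by rewrite lerD2r.
  rewrite powRN; set u := 2 `^ b in p0 *.
  have : 0 <= (u - 1) ^+ 2 / u by rewrite divr_ge0 ?sqr_ge0// ltW.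
  have -> : (u - 1) ^+ 2 / u = u - 2 + u^-1 by field; rewrite gt_eqF.
  by lra.
Qed.

(* The shift [theta] is [0] for the cosine and [- (pi / 2)] for the sine. *)
Definition phase a x t theta (y : R) : R := x * y + t * y `^ a + theta.

(** [y] times the derivative of [phase]; the factor [y] accounts for the [1 / y] in the kernel, so
    that the multiplier of the non-stationary phase argument is the inverse of this function. *)
Definition phase_euler a x t (y : R) : R := x * y + a * t * y `^ a.

Definition osc_integral a x t theta p q : R :=
  \int[mu]_(y in `[p, q]) (cos (phase a x t theta y) / y).

Lemma mulr_powRB1 (y b : R) : 0 < y -> y * y `^ (b - 1) = y `^ b.
Proof.
move=> y0; rewrite powRB; last by rewrite (gt_eqF y0) implybT.
by rewrite powRr1 ?ltW// mulrCA divff ?mulr1// gt_eqF.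
Qed.

Lemma is_derive_phase a x t theta y : 0 < y ->
  is_derive y 1 (phase a x t theta) (phase_euler a x t y / y).
Proof.
move=> y0; have hP := is_derive1_powR a y0.
have h1 := is_deriveZ x (is_derive_id y (1 : R)).
have h2 := is_deriveZ t hP.
have h := is_deriveD (is_deriveD h1 h2) (is_derive_cst theta y (1:R)).
apply: (is_derive_eq h).
rewrite /GRing.scale/= addr0 mulr1 /phase_euler -(mulr_powRB1 a y0).
by field; rewrite gt_eqF.
Qed.

Lemma is_derive_phase_euler a x t y : 0 < y ->
  is_derive y 1 (phase_euler a x t) (x + a ^+ 2 * t * y `^ (a - 1)).
Proof.
move=> y0; have hP := is_derive1_powR a y0.
have h1 := is_deriveZ x (is_derive_id y (1 : R)).
have h2 := is_deriveZ (a * t) hP.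
apply: (is_derive_eq (is_deriveD h1 h2)).
by rewrite /GRing.scale/= mulr1; ring.
Qed.

Lemma derivable_at_continuous (f : R -> R) y (d : R) :
  is_derive y 1 f d -> {for y, continuous f}.
Proof.
move=> [df _]; exact/differentiable_continuous/derivable1_diffP.
Qed.

Lemma is_derive_cos_phase_div a x t theta y : 0 < y ->
  {d | is_derive y 1 (fun y => cos (phase a x t theta y) / y) d}.
Proof.
move=> y0; have hp := is_derive_phase a x t theta y0.
have hc := @is_derive1_comp R cos (phase a x t theta) y _ _ (is_derive_cos _) hp.
have hV := is_deriveV (lt0r_neq0 y0) (is_derive_id y (1 : R)).
by eexists; exact: (is_deriveM hc hV).
Qed.

Lemma within_continuous_pos (f : R -> R) p q : 0 < p ->
  (forall y, 0 < y -> {for y, continuous f}) -> {within `[p, q], continuous f}.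
Proof.
move=> p0 cf; apply: continuous_in_subspaceT => y.
rewrite inE/= in_itv/= => /andP[py _]; apply: cf; exact: lt_le_trans py.
Qed.

Lemma integrable_cos_phase_div a x t theta p q : 0 < p ->
  mu.-integrable `[p, q] (EFin \o (fun y => cos (phase a x t theta y) / y)).
Proof.
move=> p0; apply: continuous_compact_integrable; first exact: segment_compact.
apply: within_continuous_pos => // y y0.
have [d hd] := is_derive_cos_phase_div a x t theta y0.
exact: derivable_at_continuous hd.
Qed.

(* [lam] regularizes the multiplier [1 / Psi] of the non-stationary phase
   argument, so that the estimate survives at a zero of [Psi]. *)
Lemma osc_integral_le a x t theta p q (lam : R) (W w : R -> R) :
  0 < p -> p <= q -> 0 <= lam ->
  let Psi := phase_euler a x t in
  (forall y, p <= y <= q -> 0 < Psi y ^+ 2 + lam) ->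
  (forall y, p <= y <= q -> is_derive y 1 W (w y)) ->
  (forall y, p <= y <= q ->
    lam / (y * (Psi y ^+ 2 + lam)) +
    `|x + a ^+ 2 * t * y `^ (a - 1)| / (Psi y ^+ 2 + lam) <= w y) ->
  `|osc_integral a x t theta p q| <=
    `|Psi p| / (Psi p ^+ 2 + lam) + `|Psi q| / (Psi q ^+ 2 + lam) + (W q - W p).
Proof.
move=> p0 pq lam0 Psi D0 dW wW.
pose den y := Psi y ^+ 2 + lam.
(* The boundary term of an integration by parts, with [1 / Psi] replaced by [Psi / (Psi^2 + lam)].
   Its derivative reproduces the integrand up to the two errors that [w] dominates. *)
pose M y := sin (phase a x t theta y) * (Psi y / den y).
pose J y := osc_integral a x t theta p y.
pose c y := cos (phase a x t theta y) / y.
have ci r : mu.-integrable `[p, r] (EFin \o c) by exact: integrable_cos_phase_div.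
pose Psi' y := x + a ^+ 2 * t * y `^ (a - 1).
pose dM y := cos (phase a x t theta y) * (Psi y / y) * (Psi y / den y) +
  sin (phase a x t theta y) * (Psi' y * (lam - Psi y ^+ 2) / den y ^+ 2).
have y_gt0 y : p <= y <= q -> 0 < y by move=> /andP[py _]; exact: lt_le_trans py.
have dM_ y : p <= y <= q -> is_derive y 1 M (dM y).
  move=> ypq; have y0 := y_gt0 y ypq; have den0 := D0 y ypq.
  have hs := @is_derive1_comp R sin (phase a x t theta) y _ _ (is_derive_sin _)
    (is_derive_phase a x t theta y0).
  have hP := is_derive_phase_euler a x t y0.
  have hden := is_deriveD (is_deriveM hP hP) (is_derive_cst lam y (1:R)).
  have den0' : ((phase_euler a x t * phase_euler a x t) + cst lam) y != 0.
    by rewrite !fctE -expr2 gt_eqF.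
  have hV := is_deriveV den0' hden.
  have h := is_deriveM hs (is_deriveM hP hV).
  have -> : M = (sin \o phase a x t theta) * (phase_euler a x t *
     (fun y => (((phase_euler a x t * phase_euler a x t) + cst lam) y)^-1)).
    by apply/funext => z; rewrite /M /den !fctE expr2.
  apply: (is_derive_eq h); rewrite /dM !fctE /GRing.scale/= addr0 /Psi' -expr2.
  rewrite -/Psi /den; set P := Psi y; rewrite -/P in den0.
  set S := sin _; set C := cos _; set P' := x + _.
  by field; rewrite (gt_eqF den0) (gt_eqF y0).
have dJ y : y \in `]p, q[ -> is_derive y 1 J (c y).
  rewrite in_itv/= => /andP[py yq].
  have y0 : 0 < y by exact: lt_trans py.
  have cc : {for y, continuous c}.
    have [d hd] := is_derive_cos_phase_div a x t theta y0.
    exact: derivable_at_continuous hd.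
  have [dJy JE] := continuous_FTC1_closed yq (ci q) py cc.
  by rewrite -JE; apply: DeriveDef; rewrite ?derive1E.
have cJ : {within `[p, q], continuous J}.
  exact: parameterized_integral_continuous.
have wM (f f' : R -> R) : (forall y, p <= y <= q -> is_derive y 1 f (f' y)) ->
    {within `[p, q], continuous f}.
  move=> df; apply: continuous_in_subspaceT => y.
  rewrite inE/= in_itv/= => ypq; exact: derivable_at_continuous (df y ypq).
have cM := wM _ _ dM_; have cW := wM _ _ dW.
have wB y : p <= y <= q -> `|c y - dM y| <= w y.
  move=> ypq; apply: le_trans (wW y ypq).
  have y0 := y_gt0 y ypq; have den0 := D0 y ypq.
  (* The first error is the price of regularization. The second comes from differentiating the
     multiplier, and is bounded through [|lam - Psi^2| <= Psi^2 + lam]. *)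
  have -> : c y - dM y =
      cos (phase a x t theta y) * (lam / (y * den y)) -
      sin (phase a x t theta y) * (Psi' y * (lam - Psi y ^+ 2) / den y ^+ 2).
    rewrite /c /dM opprD addrA; congr (_ - _).
    by rewrite /den; field; rewrite (gt_eqF den0) (gt_eqF y0).
  apply: (le_trans (ler_normB _ _)); apply: lerD.
    rewrite normrM -[leRHS]mul1r ler_pM//.
      by rewrite ler_norml cos_geN1 cos_le1.
    by rewrite ger0_norm// divr_ge0// mulr_ge0 ?ltW.
  rewrite normrM -[leRHS]mul1r ler_pM//.
    by rewrite ler_norml sin_geN1 sin_le1.
  rewrite normrM normfV (gtr0_norm (exprn_gt0 2 den0)) normrM -mulrA.
  rewrite ler_wpM2l// ler_pdivrMr ?exprn_gt0// expr2 mulrA mulVf ?gt_eqF// mul1r.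
  by rewrite /den ler_norml; have := sqr_ge0 (Psi y); lra.
(* The functions [J - M + W] and [J - M - W] have derivatives of constant sign, so the mean value
   theorem compares the increments directly, without integrating [w]. *)
have JM : `|J q - M q - (J p - M p)| <= W q - W p.
  rewrite ler_norml; apply/andP; split.
  - have dF y : y \in `]p, q[ -> is_derive y 1 (J - M + W) (c y - dM y + w y).
      move=> ypq; have ypq' : p <= y <= q.
        by move: ypq; rewrite in_itv/= => /andP[/ltW -> /ltW ->].
      exact: (is_deriveD (is_deriveB (dJ y ypq) (dM_ y ypq')) (dW y ypq')).
    have cF : {within `[p, q], continuous (J - M + W)}.
      move=> z; apply: cvgD; [apply: cvgB|]; [exact: cJ|exact: cM|exact: cW].
    have [z zpq] := MVT_segment pq dF cF.
    have := wB z zpq; rewrite ler_norml => /andP[h1 _].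
    have := mulr_ge0 (_ : 0 <= c z - dM z + w z) (_ : 0 <= q - p).
    rewrite !fctE subr_ge0 => /(_ _ pq) h2 E.
    by move: (h2 ltac:(lra)); rewrite -E; lra.
  - have dF y : y \in `]p, q[ -> is_derive y 1 (J - M - W) (c y - dM y - w y).
      move=> ypq; have ypq' : p <= y <= q.
        by move: ypq; rewrite in_itv/= => /andP[/ltW -> /ltW ->].
      exact: (is_deriveB (is_deriveB (dJ y ypq) (dM_ y ypq')) (dW y ypq')).
    have cF : {within `[p, q], continuous (J - M - W)}.
      move=> z; apply: cvgB; [apply: cvgB|]; [exact: cJ|exact: cM|exact: cW].
    have [z zpq] := MVT_segment pq dF cF.
    have := wB z zpq; rewrite ler_norml => /andP[_ h1].
    have := mulr_le0_ge0 (_ : c z - dM z - w z <= 0) (_ : 0 <= q - p).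
    rewrite !fctE subr_ge0 => /(_ _ pq) h2 E.
    by move: (h2 ltac:(lra)); rewrite -E; lra.
have Jp : J p = 0 by rewrite /J /osc_integral set_itv1 Rintegral_set1.
have Mle y : p <= y <= q -> `|M y| <= `|Psi y| / (Psi y ^+ 2 + lam).
  move=> ypq; rewrite /M normrM -[leRHS]mul1r ler_pM//.
    by rewrite ler_norml sin_geN1 sin_le1.
  by rewrite normrM normfV (gtr0_norm (D0 y ypq)).
have := Mle p; have := Mle q; rewrite !lexx pq => /(_ isT) Mq /(_ isT) Mp.
rewrite -/(J q).
have -> : J q = (J q - M q - (J p - M p)) + (M q - M p) by rewrite Jp; ring.
apply: (le_trans (ler_normD _ _)).
have := ler_normB (M q) (M p).
by lra.
Qed.

(** Away from the zeros of [Psi] no regularization is required and [lam = 0]. The identity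
    [y Psi' = Psi + a (a - 1) t y^a] shows that [Psi' / Psi^2] is of order [1 / (t y^(a + 1))],
    which integrates to order [1 / (t p^a)]. *)
Lemma osc_integral_far a x t theta p q c : 0 < a -> 0 < t -> 0 < c ->
  0 < p -> p <= q ->
  (forall y, p <= y <= q -> c * t * y `^ a <= `|phase_euler a x t y|) ->
  `|osc_integral a x t theta p q| <=
    (2 / c + (1 + a * `|a - 1| / c) / (a * c)) / (t * p `^ a).
Proof.
move=> a0 t0 c0 p0 pq cPsi; set Psi := phase_euler a x t in cPsi *.
(* The numerator bounds [|y Psi'| / |Psi|], the factor [1 / c] comes from the lower bound on
   [|Psi|], and [1 / a] from integrating [y^(- a - 1)]. *)
pose K := (1 + a * `|a - 1| / c) / (a * c).
have K0 : 0 < K.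
  by rewrite /K; pos.
have y_gt0 y : p <= y <= q -> 0 < y by move=> /andP[py _]; exact: lt_le_trans py.
have T0 y : 0 < y -> 0 < t * y `^ a by move=> y0; rewrite mulr_gt0 ?powR_gt0.
have Psi_gt0 y : p <= y <= q -> 0 < `|Psi y|.
  move=> ypq; apply: lt_le_trans (cPsi y ypq).
  by rewrite -mulrA mulr_gt0// T0// (y_gt0 y).
have h := @osc_integral_le a x t theta p q 0 (fun y => - (K / t) * y `^ (- a))
  (fun y => K / t * a * y `^ (- a - 1)) p0 pq (lexx 0).
apply: (le_trans (h _ _ _)) => {h}.
- move=> y ypq; rewrite addr0 -(real_normK (num_real _)) exprn_gt0//.
  exact: Psi_gt0.
- move=> y ypq; have h := is_deriveZ (- (K / t)) (is_derive1_powR (- a) (y_gt0 y ypq)).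
  by apply: (is_derive_eq h); rewrite /GRing.scale/=; ring.
- move=> y ypq; have y0 := y_gt0 y ypq; have P0 := Psi_gt0 y ypq.
  have T0y := T0 y y0.
  rewrite mul0r add0r addr0.
  have E : x + a ^+ 2 * t * y `^ (a - 1) =
      (Psi y + a * (a - 1) * (t * y `^ a)) / y.
    by rewrite /Psi /phase_euler -(mulr_powRB1 a y0); field; rewrite gt_eqF.
  have h1 : `|x + a ^+ 2 * t * y `^ (a - 1)| <=
      `|Psi y| * (1 + a * `|a - 1| / c) / y.
    rewrite E normrM normfV (gtr0_norm y0) ler_pM2r ?invr_gt0//.
    apply: (le_trans (ler_normD _ _)); rewrite [leRHS]mulrDr mulr1 lerD2l.
    rewrite !normrM (gtr0_norm a0) (gtr0_norm t0) (gtr0_norm (powR_gt0 a y0)).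
    have -> : `|Psi y| * (a * `|a - 1| / c) = a * `|a - 1| * (`|Psi y| / c).
      by ring.
    rewrite ler_wpM2l//; first by pos.
    by rewrite ler_pdivlMr// mulrC mulrA; exact: cPsi.
  rewrite ler_pdivrMr; last by rewrite -(real_normK (num_real _)) exprn_gt0.
  apply: (le_trans h1).
  have -> : y `^ (- a - 1) = (y * y `^ a)^-1.
    rewrite -opprD powRN powRD ?powRr1 ?ltW//; first by rewrite mulrC.
    by rewrite (gt_eqF y0) implybT.
  rewrite -(real_normK (num_real (Psi y))) expr2.
  set P := `|Psi y| in P0 *.
  have -> : K / t * a / (y * y `^ a) * (P * P) =
     P * (1 + a * `|a - 1| / c) / y * (P / (c * t * y `^ a)).
    have ya0 := powR_gt0 a y0.
    by rewrite /K; field; rewrite !gt_eqF.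
  rewrite ler_peMr//.
    by pos.
  rewrite ler_pdivlMr ?mul1r; first exact: cPsi.
  by rewrite -mulrA mulr_gt0.
have PsiV y : p <= y <= q -> `|Psi y| / (Psi y ^+ 2 + 0) <= (c * (t * y `^ a))^-1.
  move=> ypq; have P0 := Psi_gt0 y ypq.
  rewrite addr0 -(real_normK (num_real (Psi y))) expr2 invfM mulrA.
  rewrite divff ?gt_eqF// mul1r lef_pV2 ?posrE//; first by rewrite mulrA; exact: cPsi.
  by rewrite mulr_gt0 ?T0 ?(y_gt0 y).
have q0 : 0 < q by exact: lt_le_trans pq.
have hp := PsiV p; have := PsiV q.
rewrite !lexx pq => /(_ isT) hq; move: hp; rewrite lexx pq => /(_ isT) hp.
have pqa : (c * (t * q `^ a))^-1 <= (c * (t * p `^ a))^-1.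
  rewrite lef_pV2 ?posrE ?mulr_gt0 ?powR_gt0//.
  rewrite !ler_pM2l//; apply: ge0_ler_powR; rewrite ?nnegrE// ltW//.
have Kq : 0 <= K / t * q `^ (- a) by pos.
have -> : (2 / c + (1 + a * `|a - 1| / c) / (a * c)) / (t * p `^ a) =
   2 * (c * (t * p `^ a))^-1 + K / t * p `^ (- a).
  have pa0 := powR_gt0 a p0.
  by rewrite powRN /K; field; rewrite !gt_eqF.
by lra.
Qed.

Lemma powR_MVT (u w b : R) : 0 < u -> u <= w ->
  exists2 z, u <= z <= w & w `^ b - u `^ b = b * z `^ (b - 1) * (w - u).
Proof.
move=> u0 uw.
have df y : y \in `]u, w[ -> is_derive y 1 (@powR R ^~ b) (b * y `^ (b - 1)).
  by rewrite in_itv/= => /andP[uy _]; apply: is_derive1_powR; exact: lt_trans uy.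
have cf : {within `[u, w], continuous (@powR R ^~ b)}.
  apply: within_continuous_pos => // y y0.
  exact: derivable_at_continuous (is_derive1_powR b y0).
by have [z zuw E] := MVT_segment uw df cf; exists z => //; rewrite in_itv in zuw.
Qed.

Lemma powR_sub_ge (v y b : R) : 0 < v -> v / 2 <= y <= 2 * v ->
  `|b| * 2 `^ (- `|b - 1|) * v `^ (b - 1) * `|y - v| <= `|y `^ b - v `^ b|.
Proof.
move=> v0 /andP[vy yv].
have y0 : 0 < y by rewrite (lt_le_trans _ vy)// divr_gt0.
have key z : v / 2 <= z <= 2 * v ->
    2 `^ (- `|b - 1|) * v `^ (b - 1) <= z `^ (b - 1).
  move=> /andP[vz zv]; have z0 : 0 < z by rewrite (lt_le_trans _ vz)// divr_gt0.
  have := @powR_dyadic_bounds (z / v) (b - 1) _.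
  rewrite powR_div ?(ltW v0) ?(ltW z0)// ler_pdivlMr// mulrC vz.
  rewrite ler_pdivrMr// zv => /(_ isT) /andP[+ _].
  by rewrite ler_pdivlMr ?powR_gt0.
have [yv'|vy'] := leP y v.
- have [z /andP[yz zv] E] := powR_MVT b y0 yv'.
  rewrite (distrC (y `^ b)) (distrC y) E !normrM ler_wpM2r//.
  rewrite -mulrA ler_wpM2l// [leRHS]ger0_norm ?powR_ge0//.
  apply: key; rewrite (le_trans vy yz)/= (le_trans zv)//.
  by rewrite ler_peMl ?ler1n// ltW.
- have [z /andP[vz zy] E] := powR_MVT b v0 (ltW vy').
  rewrite E !normrM ler_wpM2r//.
  rewrite -mulrA ler_wpM2l// [leRHS]ger0_norm ?powR_ge0//.
  apply: key; rewrite (le_trans zy yv) andbT (le_trans _ vz)//.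
  by rewrite ler_pdivrMr// ler_peMr ?ler1n// ltW.
Qed.

(** Here [x] is parametrized by the positive zero [v] of [phase_euler]; the size of the phase
    derivative then becomes a comparison of [y] with [v]. *)
Lemma phase_euler_factor a t v y : 0 < y ->
  phase_euler a (- (a * t * v `^ (a - 1))) t y =
  a * t * y * (y `^ (a - 1) - v `^ (a - 1)).
Proof. by move=> y0; rewrite /phase_euler -(mulr_powRB1 a y0); ring. Qed.

Lemma phase_euler_far a t v y : 0 < a -> 0 < t -> 0 < v -> 0 < y ->
  (y <= v / 2) || (2 * v <= y) ->
  a * (1 - 2 `^ (- `|a - 1|)) * t * y `^ a <=
    `|phase_euler a (- (a * t * v `^ (a - 1))) t y|.
Proof.
move=> a0 t0 v0 y0 yv.
have -> : phase_euler a (- (a * t * v `^ (a - 1))) t y =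
    a * t * y `^ a * (1 - (v / y) `^ (a - 1)).
  rewrite phase_euler_factor// powR_div ?ltW// -(mulr_powRB1 a y0).
  by have ya := powR_gt0 (a - 1) y0; field; rewrite gt_eqF.
rewrite normrM (gtr0_norm (mulr_gt0 (mulr_gt0 a0 t0) (powR_gt0 a y0))).
rewrite [leLHS](_ : _ = a * t * y `^ a * (1 - 2 `^ (- `|a - 1|))); last by ring.
rewrite ler_pM2l ?mulr_gt0 ?powR_gt0//; apply: powR_gap; first exact: divr_gt0.
case/orP : yv => h; apply/orP; [right|left].
- by rewrite ler_pdivlMr// mulrC -ler_pdivlMr.
- by rewrite ler_pdivrMr// ler_pdivlMl.
Qed.

(** At [a = 1] this constant would be 0: the phase is then linear in [y], with no isolated
    stationary point. *)
Lemma powR_gap_gt0 a : a != 1 -> 0 < a -> 0 < a * (1 - 2 `^ (- `|a - 1|)).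
Proof.
move=> a1 a0; rewrite mulr_gt0// subr_gt0 powRN invf_lt1 ?powR_gt0//.
have b0 : 0 < `|a - 1| by rewrite normr_gt0 subr_eq0.
rewrite -[ltLHS](powRr0 2) /powR !gt_eqF// ltr_expR mul0r mulr_gt0//.
by rewrite ln_gt0// ltr1n.
Qed.

(** Regularize with [lam = m], where [m = t v^a]. Since [Psi] vanishes at [v] with slope at least of
    order [m / v], one has [Psi^2 + m >= m (1 + k^2 (y - v)^2)] for [k] of order [sqrt m / v]. The
    errors are thus dominated by the derivative of an arctangent, whose total variation is bounded
    whatever the segment. *)
Lemma osc_integral_near a : 0 < a -> a != 1 ->
  exists2 C, 0 < C & forall t v theta p q, 0 < t -> 0 < v ->
    v / 2 <= p -> p <= q -> q <= 2 * v ->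
    `|osc_integral a (- (a * t * v `^ (a - 1))) t theta p q| <=
      C / Num.sqrt (t * v `^ a).
Proof.
move=> a0 a1; pose b := a - 1.
have b0 : 0 < `|b| by rewrite normr_gt0 subr_eq0.
(* [c] is the slope constant of [Psi], its [1 / 2] coming from [v / 2 <= y]; [K] bounds [|Psi'|] in
   units of [m / v]. In [C], the 2 stands for the two endpoint terms and [pi] for the variation of
   the arctangent. *)
pose c := a / 2 * (`|b| * 2 `^ (- `|b - 1|)).
have c0 : 0 < c by rewrite !mulr_gt0 ?powR_gt0.
pose K := a * (1 + a * 2 `^ `|b|).
have K0 : 0 < K by rewrite /K; pos.
pose C := 2 + (2 + K) / c * pi.
have pi0 : 0 < pi :> R by exact: pi_gt0.
have C0 : 0 < C by rewrite /C; pos.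
exists C => // t v theta p q t0 v0 vp pq qv.
set x := - _.
pose m := t * v `^ a.
have m0 : 0 < m by rewrite mulr_gt0 ?powR_gt0.
pose s := Num.sqrt m; have s0 : 0 < s by rewrite sqrtr_gt0.
have sm : s ^+ 2 = m by rewrite sqr_sqrtr// ltW.
have vm : t * v `^ b = m / v.
  by rewrite /m -(mulr_powRB1 a v0) -/b; field; rewrite gt_eqF.
pose Psi := phase_euler a x t.
have y_near y : p <= y <= q -> v / 2 <= y <= 2 * v.
  by move=> /andP[py yq]; rewrite (le_trans vp py) (le_trans yq qv).
have y_gt0 y : v / 2 <= y <= 2 * v -> 0 < y.
  by move=> /andP[vy _]; rewrite (lt_le_trans _ vy)// divr_gt0.
have p0 : 0 < p by rewrite (lt_le_trans _ vp)// divr_gt0.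
have PsiE y : v / 2 <= y <= 2 * v -> c * m / v * `|y - v| <= `|Psi y|.
  move=> yv; have y0 := y_gt0 y yv.
  rewrite /Psi /x phase_euler_factor// normrM.
  rewrite (gtr0_norm (mulr_gt0 (mulr_gt0 a0 t0) y0)).
  apply: le_trans (_ : a * t * (v / 2) *
    (`|b| * 2 `^ (- `|b - 1|) * v `^ (b - 1) * `|y - v|) <= _).
    rewrite le_eqVlt; apply/orP; left; apply/eqP.
    have -> : c * m / v = c * (t * v `^ b) by rewrite vm; ring.
    by rewrite -(mulr_powRB1 b v0) /c; field.
  rewrite ler_pM//.
  - by pos.
  - by rewrite !mulr_ge0 ?powR_ge0.
  - by rewrite ler_pM2l ?mulr_gt0//; case/andP : yv.
  - exact: powR_sub_ge.
pose k := c * s / v; have k0 : 0 < k by rewrite divr_gt0 ?mulr_gt0.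
pose W y := (2 + K) / (c * s) * atan (k * (y - v)).
pose w y := (2 + K) / v * (1 + (k * (y - v)) ^+ 2)^-1.
have D0 y : 0 < Psi y ^+ 2 + m by rewrite ltr_wpDl ?sqr_ge0.
have h := @osc_integral_le a x t theta p q m W w p0 pq (ltW m0).
apply: (le_trans (h _ _ _)) => {h}.
- by move=> y _; exact: D0.
- move=> y _.
  have hk : is_derive y 1 (fun y => k * (y - v)) k.
    rewrite (_ : (fun y => _) = (fun y => k * y - k * v)); last first.
      by apply/funext => z; rewrite mulrBr.
    by apply: is_derive_eq; rewrite /GRing.scale/= mulr1 oppr0 addr0.
  have ha := @is_derive1_comp R atan (fun y => k * (y - v)) y _ _
    (is_derive1_atan _) hk.
  apply: (is_derive_eq (is_deriveZ ((2 + K) / (c * s)) ha)).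
  have u0 : 1 + (k * (y - v)) ^+ 2 != 0 by rewrite gt_eqF// ltr_pwDl// sqr_ge0.
  rewrite /GRing.scale/= /w [in X in _ * X]/k.
  set U := 1 + _; rewrite -/U in u0.
  by field; rewrite u0 !gt_eqF.
- move=> y /y_near yv; have y0 := y_gt0 y yv.
  have h1 : m / (y * (Psi y ^+ 2 + m)) <= 2 * (m / v) / (Psi y ^+ 2 + m).
    have D0y := D0 y.
    have -> : m / (y * (Psi y ^+ 2 + m)) = m / y / (Psi y ^+ 2 + m).
      by field; rewrite !gt_eqF.
    rewrite ler_pM2r ?invr_gt0// mulrCA ler_pM2l//.
    rewrite ler_pdivlMr// mulrC ler_pdivrMr//.
    by case/andP : yv => + _; rewrite ler_pdivrMr// mulrC.
  have h2 : `|x + a ^+ 2 * t * y `^ (a - 1)| <= K * (m / v).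
    rewrite (le_trans (ler_normD _ _))// -vm /K /x normrN.
    have -> : `|a * t * v `^ (a - 1)| = a * t * v `^ b.
      by rewrite ger0_norm//; pos.
    have -> : `|a ^+ 2 * t * y `^ (a - 1)| = a ^+ 2 * t * y `^ b.
      by rewrite ger0_norm//; pos.
    have := @powR_dyadic_bounds (y / v) b _.
    case/andP : (yv) => vy yv'.
    rewrite powR_div ?(ltW v0) ?(ltW y0)// ler_pdivlMr// mulrC vy.
    rewrite ler_pdivrMr// yv' => /(_ isT) /andP[_ +].
    rewrite ler_pdivrMr ?powR_gt0// => hy.
    have := ler_wpM2l (ltW (mulr_gt0 (exprn_gt0 2 a0) t0)) hy.
    by rewrite expr2; lra.
  apply: (@le_trans _ _ ((2 + K) * (m / v) / (Psi y ^+ 2 + m))).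
    rewrite mulrDl mulrDl lerD//.
    by rewrite ler_pM2r ?invr_gt0.
  set u := k * (y - v).
  have -> : w y = (2 + K) * (m / v) / (m * (1 + u ^+ 2)).
    have u0 : 0 < 1 + u ^+ 2 by pos.
    by rewrite /w -/u; field; rewrite !gt_eqF.
  rewrite ler_pM2l; last by pos.
  rewrite lef_pV2 ?posrE ?D0//; last by pos.
  have -> : m * (1 + u ^+ 2) = (c * m / v * `|y - v|) ^+ 2 + m.
    by rewrite [in RHS]exprMn real_normK ?num_real// /u /k -sm; field; rewrite gt_eqF.
  by rewrite lerD2r -[leRHS]real_normK ?num_real// ler_sqr ?nnegrE ?PsiE//; pos.
have PsiV y : `|Psi y| / (Psi y ^+ 2 + m) <= s^-1.
  rewrite ler_pdivrMr ?D0// mulrC ler_pdivlMr// -sm -(real_normK (num_real (Psi y))).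
  have := sqr_ge0 (`|Psi y| - s).
  have : 0 <= `|Psi y| * s by pos.
  set P := `|Psi y|; rewrite sqrrB => h1 h2.
  by lra.
have Wpq : W q - W p <= (2 + K) / c * pi / s.
  rewrite /W -mulrBr.
  have -> : (2 + K) / c * pi / s = (2 + K) / (c * s) * pi.
    by field; rewrite !gt_eqF.
  rewrite ler_wpM2l//; first by pos.
  have := atan_ltpi2 (k * (q - v)); have := atan_gtNpi2 (k * (p - v)).
  by lra.
have hp := PsiV p; have hq := PsiV q.
have -> : C / s = s^-1 + s^-1 + (2 + K) / c * pi / s.
  by rewrite /C; field; rewrite !gt_eqF.
by rewrite lerD// lerD.
Qed.

End OscillatoryIntegral.

(** * Exchange of integrals, weighted Cauchy-Schwarz and integrals of powers *)

Section WeightedEstimates.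
Context {R : realType}.
Local Notation mu := (@lebesgue_measure R).
Implicit Types (D : set R) (f g : R -> R).

Lemma EFin_Rintegral D f : measurable D -> mu.-integrable D (EFin \o f) ->
  (\int[mu]_(x in D) f x)%:E = (\int[mu]_(x in D) (f x)%:E)%E.
Proof. by move=> mD fi; rewrite /Rintegral fineK//; exact: integrable_fin_num. Qed.

Lemma Rintegral_split f (p m q : R) : p <= m -> m <= q ->
  mu.-integrable `[p, q] (EFin \o f) ->
  \int[mu]_(x in `[p, q]) f x =
  \int[mu]_(x in `[p, m]) f x + \int[mu]_(x in `[m, q]) f x.
Proof.
move=> pm mq fi; have fmq : mu.-integrable `[m, q] (EFin \o f).
  by apply: integrableS fi => //; apply: subset_itv; rewrite bnd_simp.
have := Rintegral_itvB fi (x := m); rewrite !bnd_simp => /(_ pm mq).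
rewrite Rintegral_itv_obnd_cbnd; last first.
  by apply: integrableS fmq => //; exact: subset_itv_oc_cc.
by move=> <-; rewrite addrC subrK.
Qed.

(** Fubini on the triangle [p <= s <= y <= q]. The triangle is encoded by cutting both factors off
    outside [[p, q]] and multiplying by the indicator of [s <= y] on the whole plane; absolute
    integrability follows from that of the product of the factors. *)
Lemma Rintegral_triangle (c g : R -> R) (p q : R) :
  mu.-integrable `[p, q] (EFin \o c) -> mu.-integrable `[p, q] (EFin \o g) ->
  \int[mu]_(y in `[p, q]) (c y * \int[mu]_(s in `[p, y]) g s) =
  \int[mu]_(s in `[p, q]) (g s * \int[mu]_(y in `[s, q]) c y).
Proof.
move=> ci gi; set I := `[p, q]%classic.
have mI : measurable I by exact: measurable_itv.
pose c1 := c \_ I; pose g1 := g \_ I.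
have restr h : mu.-integrable I (EFin \o h) ->
    mu.-integrable setT (EFin \o (h \_ I)).
  by move=> hi; rewrite -restrict_EFin; exact: (iffLR (integrable_mkcond _ _)).
have c1i : mu.-integrable setT (EFin \o c1) by exact: restr.
have g1i : mu.-integrable setT (EFin \o g1) by exact: restr.
have mc1 : measurable_fun setT c1.
  by apply/measurable_EFinP; exact: measurable_int c1i.
have mg1 : measurable_fun setT g1.
  by apply/measurable_EFinP; exact: measurable_int g1i.
pose A : set (measurableTypeR R * measurableTypeR R) := [set z | z.2 <= z.1].
have mA : measurable A.
  have := @measurable_fun_ler _ (measurableTypeR R * measurableTypeR R)%type R
    setT snd fst measurable_snd measurable_fst.
  move=> /(_ measurableT [set true] _); rewrite setTI.
  rewrite (_ : _ @^-1` _ = A); first exact.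
  by apply/seteqP; split.
pose F (z : measurableTypeR R * measurableTypeR R) : \bar R :=
  (c1 z.1 * g1 z.2 * \1_A z)%:E.
have mF : measurable_fun setT F.
  apply/measurable_EFinP; apply: measurable_funM; last exact: measurable_indic.
  apply: measurable_funM.
  - by apply: (measurableT_comp mc1); exact: measurable_fst.
  - by apply: (measurableT_comp mg1); exact: measurable_snd.
have Fi : (mu \x mu)%E.-integrable setT F.
  apply/integrable12ltyP => //.
  have [_ c1oo] := integrableP _ _ _ c1i; have [_ g1oo] := integrableP _ _ _ g1i.
  apply: (@le_lt_trans _ _ (\int[mu]_x (`|c1 x|%:E * \int[mu]_y `|g1 y|%:E))%E).
    apply: ge0_le_integral => //.
    - by move=> x _; exact: integral_ge0.
    - apply: (measurable_fun_fubini_tonelli_F (abse \o F)) => //=.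
      exact: measurableT_comp.
    - apply: emeasurable_funM => //.
      by apply/measurable_EFinP; exact: measurableT_comp.
    - move=> x _; rewrite -ge0_integralZl//; last first.
        by apply/measurable_EFinP; exact: measurableT_comp.
      apply: ge0_le_integral => //.
      + apply: measurableT_comp => //.
        by apply: (measurableT_comp mF); exact: pair1_measurable.
      + apply: emeasurable_funM => //.
        by apply/measurable_EFinP; exact: measurableT_comp.
      + move=> y _; rewrite /F/= -EFinM lee_fin !normrM ler_piMr//.
        by rewrite indicE; case: (_ \in _); rewrite ?normr1 ?normr0.
  rewrite -(fineK (_ : (\int[mu]_y `|g1 y|%:E)%E \is a fin_num)); last first.
    by rewrite ge0_fin_numE// integral_ge0.
  rewrite ge0_integralZr//; last first.
  - by rewrite lee_fin fine_ge0// integral_ge0.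
  - by apply/measurable_EFinP; exact: measurableT_comp.
  by rewrite muleC lte_mul_pinfty// lee_fin fine_ge0// integral_ge0.
have sub_l y : I y -> `[p, y] `<=` I.
  by rewrite /I/= in_itv/= => /andP[_ yq]; apply: subset_itv; rewrite bnd_simp.
have sub_r s : I s -> `[s, q] `<=` I.
  by rewrite /I/= in_itv/= => /andP[ps _]; apply: subset_itv; rewrite bnd_simp.
have inner_l y : (\int[mu]_s F (y, s) =
    ((fun y => c y * \int[mu]_(s in `[p, y]) g s) \_ I y)%:E)%E.
  rewrite patchE; case: ifPn => [|yI]; last first.
    rewrite integral0_eq// => s _.
    by rewrite /F/= /c1 patchE (negbTE yI) !mul0r.
  rewrite inE => yI.
  have gy := @integrableS _ _ _ mu _ _ _ mI (measurable_itv _) (sub_l y yI) gi.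
  rewrite EFinM EFin_Rintegral// -integralZl// integral_mkcond.
  apply: eq_integral => s _; rewrite /F/= indicE !patchE /c1 /g1 !patchE mem_set//.
  case: ifPn => sI.
  - have [sy|ys] := leP s y.
      rewrite mem_set// mulr1 mem_set//=; move: sI; rewrite inE/I/= !in_itv/=.
      by move=> /andP[-> _].
    rewrite !memNset ?mulr0//.
      by rewrite /= in_itv/= (leNgt s) ys andbF.
    by rewrite /A/= leNgt ys.
  (* Off the set, the restriction returns the default [point], which is 0 in [R]. *)
  - have -> : (point : R) = 0 by [].
    rewrite mulr0 mul0r ifF//; apply/negP => /set_mem h.
    by move: sI; rewrite mem_set//; exact: sub_l h.
have inner_r s : (\int[mu]_y F (y, s) =
    ((fun s => g s * \int[mu]_(y in `[s, q]) c y) \_ I s)%:E)%E.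
  rewrite patchE; case: ifPn => [|sI]; last first.
    rewrite integral0_eq// => y _.
    by rewrite /F/= /g1 patchE (negbTE sI) mulr0 mul0r.
  rewrite inE => sI.
  have cs := @integrableS _ _ _ mu _ _ _ mI (measurable_itv _) (sub_r s sI) ci.
  rewrite EFinM EFin_Rintegral// -integralZl// integral_mkcond.
  apply: eq_integral => y _; rewrite /F/= indicE !patchE /c1 /g1 !patchE (mem_set sI).
  case: ifPn => yI.
  - have [sy|ys] := leP s y.
      rewrite (mem_set (_ : A (y, s)))// mulr1 mem_set ?(mulrC (c y))//=.
      by move: yI; rewrite inE/I/= !in_itv/= sy => /andP[_ ->].
    rewrite !memNset ?mulr0//.
      by rewrite /= in_itv/= (leNgt s) ys.
    by rewrite /A/= leNgt ys.
  - have -> : (point : R) = 0 by [].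
    rewrite !mul0r ifF//; apply/negP => /set_mem h.
    by move: yI; rewrite mem_set//; exact: sub_r h.
have := Fubini Fi.
under eq_integral do rewrite inner_l.
under [in X in _ = X -> _]eq_integral do rewrite inner_r.
move=> /(congr1 fine) E.
by rewrite [LHS]Rintegral_mkcond [RHS]Rintegral_mkcond; exact: E.
Qed.

(** Stated with upper bounds [N] and [B], it follows from the pointwise inequality
    [|g| k <= l s^(- b) g^2 + r s^b k^2]. With [l = B / (2 N)] and [r = N / (2 B)] the defect is a
    square, and the two terms contribute at most [N B / 2] each. *)
Lemma weighted_cauchy_schwarz (b : R) D g (k : R -> R) (N B : R) :
  0 < N -> 0 < B -> measurable D -> (forall s, D s -> 0 < s) ->
  measurable_fun D g -> measurable_fun D k -> (forall s, D s -> 0 <= k s) ->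
  (\int[mu]_(s in D) (s `^ (- b) * g s ^+ 2)%:E <= (N ^+ 2)%:E)%E ->
  (\int[mu]_(s in D) (s `^ b * k s ^+ 2)%:E <= (B ^+ 2)%:E)%E ->
  (\int[mu]_(s in D) (`|g s| * k s)%:E <= (N * B)%:E)%E.
Proof.
move=> N0 B0 mD D0 mg mk k0 gN kB.
have mw c (h : R -> R) : measurable_fun D h -> measurable_fun D (fun s => s `^ c * h s ^+ 2).
  move=> mh; apply: measurable_funM; last exact: measurable_funX.
  by apply: measurable_funTS; exact: measurable_powR.
have mwE c (h : R -> R) : measurable_fun D h ->
    measurable_fun D (fun s => (s `^ c * h s ^+ 2)%:E).
  by move=> mh; apply/measurable_EFinP; exact: mw.
pose l : R := B / (2 * N); pose r : R := N / (2 * B).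
have l0 : 0 <= l by rewrite /l; pos.
have r0 : 0 <= r by rewrite /r; pos.
apply: (@le_trans _ _ (\int[mu]_(s in D)
   (l%:E * (s `^ (- b) * g s ^+ 2)%:E + r%:E * (s `^ b * k s ^+ 2)%:E))%E).
  apply: ge0_le_integral => //.
  - by move=> s Ds; rewrite lee_fin mulr_ge0 ?k0.
  - apply/measurable_EFinP; apply: measurable_funM => //.
    exact: measurableT_comp.
  - by apply: emeasurable_funD; apply: emeasurable_funM => //; exact: mwE.
  - move=> s Ds; rewrite -!EFinM -EFinD lee_fin.
    have s0 := D0 s Ds; have sb := powR_gt0 b s0.
    rewrite powRN -(real_normK (num_real (g s))).
    set G := `|g s|; set K := k s; set P := s `^ b in sb *.
    have G0 : 0 <= G by exact: normr_ge0.
    rewrite -subr_ge0.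
    have -> : l * (P^-1 * G ^+ 2) + r * (P * K ^+ 2) - G * K =
      (B * G - N * (P * K)) ^+ 2 / (2 * N * B * P).
      by rewrite /l /r; field; rewrite !gt_eqF.
    by pos.
rewrite ge0_integralD//; last 4 first.
- by move=> s Ds; rewrite -EFinM lee_fin mulr_ge0// mulr_ge0 ?powR_ge0 ?sqr_ge0.
- by apply: emeasurable_funM => //; exact: mwE.
- by move=> s Ds; rewrite -EFinM lee_fin mulr_ge0// mulr_ge0 ?powR_ge0 ?sqr_ge0.
- by apply: emeasurable_funM => //; exact: mwE.
have pw c (h : R -> R) s : (0 <= (s `^ c * h s ^+ 2)%:E)%E.
  by rewrite lee_fin mulr_ge0 ?powR_ge0 ?sqr_ge0.
rewrite !ge0_integralZl//; try exact: mwE.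
apply: (@le_trans _ _ (l%:E * (N ^+ 2)%:E + r%:E * (B ^+ 2)%:E)%E).
  by apply: leeD; apply: lee_wpmul2l.
rewrite -!EFinM -EFinD lee_fin /l /r le_eqVlt; apply/orP; left; apply/eqP.
by field; rewrite !gt_eqF.
Qed.

Lemma Rintegral_powR (b p q : R) : b != 0 -> 0 < p -> p <= q ->
  \int[mu]_(s in `[p, q]) s `^ (b - 1) = b^-1 * (q `^ b - p `^ b).
Proof.
move=> b0 p0; rewrite le_eqVlt => /predU1P[<-|pq].
  by rewrite set_itv1 Rintegral_set1 subrr mulr0.
have dF (y : R) : 0 < y ->
    is_derive y 1 (fun s => b^-1 * s `^ b) (y `^ (b - 1)).
  move=> y0; apply: (is_derive_eq (is_deriveZ b^-1 (is_derive1_powR b y0))).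
  by rewrite /GRing.scale/= mulrA mulVf// mul1r.
rewrite /Rintegral (@continuous_FTC2 R _ (fun s => b^-1 * s `^ b))//.
- by rewrite /= mulrBr.
- apply: within_continuous_pos => // y y0.
  exact: derivable_at_continuous (is_derive1_powR (b - 1) y0).
- split => [y||].
  + rewrite in_itv/= => /andP[py _].
    by have [h _] := dF y (lt_trans p0 py); exact: h.
  + apply: cvg_at_right_filter; exact: derivable_at_continuous (dF p p0).
  + apply: cvg_at_left_filter; apply: derivable_at_continuous (dF q _).
    exact: lt_trans pq.
- move=> y; rewrite in_itv/= => /andP[py _].
  by have [_ h] := dF y (lt_trans p0 py); rewrite derive1E; exact: h.
Qed.

Lemma integrable_powR (b p q : R) : 0 < p ->
  mu.-integrable `[p, q] (EFin \o (fun s => s `^ b)).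
Proof.
move=> p0; apply: continuous_compact_integrable; first exact: segment_compact.
apply: within_continuous_pos => // y y0.
exact: derivable_at_continuous (is_derive1_powR b y0).
Qed.

End WeightedEstimates.

(** * Oscillatory integrals on a half line *)

Section HalfLine.
Context {R : realType}.
Local Notation mu := (@lebesgue_measure R).
Implicit Types (f g : R -> R) (a N x t theta p q : R).

Lemma abs_Rintegral_le (D : set R) f : measurable D ->
  measurable_fun D f ->
  (`|\int[mu]_(x in D) f x|%:E <= \int[mu]_(x in D) `|f x|%:E)%E.
Proof.
move=> mD mf; have h := @le_abse_integral _ _ _ mu D (EFin \o f) mD _.
apply: le_trans (h _); last exact/measurable_EFinP.
(* An infinite integral has real value 0 by default, and its absolute value as an extended real is
   infinite, so the bound persists. *)
by rewrite /Rintegral; case: (integral _ _ _) => //=; rewrite normr0 leey.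
Qed.

(** Powers of [y] and the kernel [1 / y] are handled only on segments with positive left end; the
    missing piece over [[0, d]] is made arbitrarily small by local integrability. *)
Lemma Rintegral_from0_le f q (M : R) : locally_integrable setT f -> 0 < q ->
  (forall d, 0 < d -> d <= q -> `|\int[mu]_(y in `[d, q]) f y| <= M) ->
  `|\int[mu]_(y in `[0, q]) f y| <= M.
Proof.
move=> lf q0 fM; apply/ler_addgt0Pr => e e0.
have fi := locally_integrable_segment 0 q lf.
have h0 := parameterized_integral_cvg_left q0 fi.
have [d /= d0 hd] := (cvgr0Pnorm_lt _).1 h0 e e0.
pose m := Num.min (d / 2) q.
have m0 : 0 < m by rewrite lt_min q0 divr_gt0.
have mq : m <= q by rewrite ge_min lexx orbT.
have md : m < d by rewrite gt_min ltr_pdivrMr// ltr_pMr// ltr1n.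
rewrite (Rintegral_split (ltW m0) mq fi) addrC (le_trans (ler_normD _ _))//.
apply: lerD; first exact: fM.
apply: ltW; apply: (hd m); rewrite /= sub0r normrN gtr0_norm//.
Qed.

(** The data on a positive half line. The weight [1 - a] is twice the Sobolev order [(1 - a) / 2],
    and [N] is only an upper bound for the norm of [g], so that it can be taken positive even when
    [g] vanishes. *)
Definition primitive_pair (a N : R) f g : Prop :=
  [/\ locally_integrable setT f, locally_integrable setT g,
      {ae mu, forall b : R, 0 < b -> b * f b = - a * \int[mu]_(s in `[0, b]) g s} &
      (\int[mu]_(s in `]0%R, +oo[) (s `^ (1 - a) * g s ^+ 2)%:E
        <= (N ^+ 2)%:E)%E].

Lemma primitive_pair_cauchy_schwarz a N f g p q (k : R -> R) (B : R) :
  0 < N -> 0 < B -> 0 < p -> primitive_pair a N f g ->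
  measurable_fun `[p, q] k -> (forall s, p <= s <= q -> 0 <= k s) ->
  (\int[mu]_(s in `[p, q]) (s `^ (a - 1) * k s ^+ 2)%:E <= (B ^+ 2)%:E)%E ->
  (\int[mu]_(s in `[p, q]) (`|g s| * k s)%:E <= (N * B)%:E)%E.
Proof.
move=> N0 B0 p0 [_ [mg _ _] _ gN] mk k0 kB.
have mD : measurable (`[p, q] : set R) by exact: measurable_itv.
apply: (@weighted_cauchy_schwarz _ (a - 1) _ _ _ _ _ N0 B0 mD _ _ mk _ _ kB).
- by move=> s; rewrite /= in_itv/= => /andP[ps _]; exact: lt_le_trans ps.
- exact: measurable_funTS.
- by move=> s; rewrite /= in_itv/=; exact: k0.
- apply: le_trans gN; rewrite opprB; apply: ge0_subset_integral => //.
  + apply/measurable_EFinP; apply: measurable_funM.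
      by apply: measurable_funTS; exact: measurable_powR.
    by apply: measurable_funX; exact: measurable_funTS.
  + by move=> s _; rewrite lee_fin mulr_ge0 ?powR_ge0 ?sqr_ge0.
  + move=> s; rewrite /= !in_itv/= andbT => /andP[ps _].
    exact: lt_le_trans ps.
Qed.

Lemma integral_powR (b p q : R) : b != 0 -> 0 < p -> p <= q ->
  (\int[mu]_(s in `[p, q]) (s `^ (b - 1))%:E =
    (b^-1 * (q `^ b - p `^ b))%:E)%E.
Proof.
move=> b0 p0 pq; rewrite -(Rintegral_powR b0 p0 pq) EFin_Rintegral//.
exact: integrable_powR.
Qed.

Lemma powR_half_sqr (p a : R) : (p `^ (a / 2)) ^+ 2 = p `^ a.
Proof. by rewrite -powR_mulrn ?powR_ge0// -powRrM divfK. Qed.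

(** Cauchy-Schwarz with kernel 1: the dual weight [s^(a - 1)] is integrable at 0 because [0 < a],
    with integral at most [p^a / a] up to [p]. *)
Lemma primitive_le a N f g p : 0 < a -> 0 < N -> 0 < p ->
  primitive_pair a N f g ->
  `|\int[mu]_(s in `[0, p]) g s| <= N * (Num.sqrt a^-1 * p `^ (a / 2)).
Proof.
move=> a0 N0 p0 fg; have [_ lg _ _] := fg; have [mg _ _] := lg.
apply: Rintegral_from0_le => // d d0 dp.
rewrite -lee_fin.
apply: le_trans (abs_Rintegral_le _ (measurable_funTS mg)) _ => //.
have B0 : 0 < Num.sqrt a^-1 * p `^ (a / 2).
  by rewrite mulr_gt0 ?sqrtr_gt0 ?invr_gt0// powR_gt0.
have -> : (\int[mu]_(s in `[d, p]) `|g s|%:E =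
    \int[mu]_(s in `[d, p]) (`|g s| * cst 1 s)%:E)%E.
  by apply: eq_integral => s _; rewrite mulr1.
apply: (primitive_pair_cauchy_schwarz N0 B0 d0 fg) => //.
under eq_integral do rewrite expr1n mulr1.
rewrite integral_powR ?gt_eqF// lee_fin exprMn powR_half_sqr.
rewrite sqr_sqrtr; last by rewrite invr_ge0 ltW.
rewrite ler_pM2l ?invr_gt0//.
by rewrite lerBlDr lerDl powR_ge0.
Qed.

Definition osc_segment a x t theta f p q : R :=
  \int[mu]_(y in `[p, q]) (f y * cos (phase a x t theta y)).

Lemma measurable_cos_phase a x t theta :
  measurable_fun setT (fun y : R => cos (phase a x t theta y)).
Proof.
apply: measurableT_comp; first exact: continuous_measurable_fun (@continuous_cos R).
apply: measurable_funD => //; apply: measurable_funD; apply: measurable_funM => //.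
Qed.

Lemma locally_integrable_osc a x t theta f : locally_integrable setT f ->
  locally_integrable setT (fun y => f y * cos (phase a x t theta y)).
Proof.
move=> [mf oT fi]; have mc := measurable_cos_phase a x t theta.
split => //; first exact: measurable_funM.
move=> K KT cK; apply: le_lt_trans (fi K KT cK).
have mK := compact_measurable cK.
apply: ge0_le_integral => //.
- apply/measurable_EFinP; apply: measurableT_comp => //.
  by apply: measurable_funTS; exact: measurable_funM.
- by apply/measurable_EFinP; apply: measurableT_comp => //; exact: measurable_funTS.
- move=> y _; rewrite lee_fin normrM ler_piMr//.
  by rewrite ler_norml cos_geN1 cos_le1.
Qed.

(** The primitive of [g] is split at [p]. Its value at [p] is a constant multiplying the kernel from
    [p] to [q], which gives the first term. The remainder starts at [p], away from the singularity
    of [1 / y], and the exchange over the triangle turns it into [g(s)] against the kernel from [s]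
    to [q], which gives the second. *)
Lemma osc_segment_le a N f g x t theta p q (k : R -> R) (B : R) :
  0 < a -> 0 < N -> 0 < B -> 0 < p -> p <= q -> primitive_pair a N f g ->
  measurable_fun `[p, q] k ->
  (forall s, p <= s <= q -> `|osc_integral a x t theta s q| <= k s) ->
  (\int[mu]_(s in `[p, q]) (s `^ (a - 1) * k s ^+ 2)%:E <= (B ^+ 2)%:E)%E ->
  `|osc_segment a x t theta f p q| <=
    a * (N * (Num.sqrt a^-1 * p `^ (a / 2))) * k p + a * (N * B).
Proof.
move=> a0 N0 B0 p0 pq fg mk Jk kB; have [lf lg fgae _] := fg.
have [mg _ _] := lg; have [mf _ _] := lf.
pose c y := cos (phase a x t theta y) / y.
have ci r : mu.-integrable `[p, r] (EFin \o c) by exact: integrable_cos_phase_div.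
have gi := locally_integrable_segment p q lg.
have gi0 := locally_integrable_segment 0 q lg.
pose G y := \int[mu]_(s in `[p, y]) g s.
pose G0 := \int[mu]_(s in `[0, p]) g s.
have cG : {within `[p, q], continuous G}.
  exact: parameterized_integral_continuous.
have cc : {within `[p, q], continuous c}.
  apply: within_continuous_pos => // y y0.
  have [d hd] := is_derive_cos_phase_div a x t theta y0.
  exact: derivable_at_continuous hd.
have cGi : mu.-integrable `[p, q] (EFin \o (fun y => c y * G y)).
  apply: continuous_compact_integrable; first exact: segment_compact.
  by move=> y; apply: cvgM; [exact: cc|exact: cG].
have E1 : osc_segment a x t theta f p q =
    \int[mu]_(y in `[p, q]) (- a * (G0 * c y + c y * G y)).
  congr fine; apply: ae_eq_integral => //.
  - apply/measurable_EFinP; apply: measurable_funTS; apply: measurable_funM => //.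
    exact: measurable_cos_phase.
  - apply/measurable_EFinP; apply: measurable_funM => //.
    apply: measurable_funD.
      apply: measurable_funM => //.
      by apply/measurable_EFinP; exact: measurable_int (ci q).
    by apply/measurable_EFinP; exact: measurable_int cGi.
  - move: fgae; apply: filterS; first exact: (ae_filter_ringOfSetsType mu).
    move=> y hy; rewrite /= in_itv/= => /andP[py yq]; congr (_%:E).
    have y0 : 0 < y by exact: lt_le_trans py.
    have gy0 := locally_integrable_segment 0 y lg.
    have := hy y0; rewrite (Rintegral_split (ltW p0) py gy0) -/G0 -/(G y) => hfy.
    rewrite [RHS](_ : _ = - a * (G0 + G y) * c y); last by ring.
    by rewrite -hfy /c; field; rewrite gt_eqF.
have Zi : mu.-integrable `[p, q] (EFin \o (fun y => G0 * c y)).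
  have := @integrableZl _ _ _ mu _ (measurable_itv _) G0 _ (ci q).
  by congr integrable.
rewrite E1 RintegralZl//; last first.
  have := @integrableD _ _ _ mu _ (measurable_itv _) _ _ Zi cGi.
  by congr integrable.
rewrite RintegralD//.
rewrite RintegralZl// /G Rintegral_triangle// -/(osc_integral a x t theta p q).
rewrite normrM normrN (gtr0_norm a0) -mulrA -mulrDr ler_pM2l//.
rewrite (le_trans (ler_normD _ _))//; apply: lerD.
  rewrite normrM; apply: ler_pM => //; first exact: (primitive_le a0 N0 p0 fg).
  by apply: Jk; rewrite lexx.
(* Measurability in the lower endpoint: the kernel is a constant minus an integral depending
   continuously on its upper endpoint. *)
have mJ : measurable_fun `[p, q] (fun s => \int[mu]_(y in `[s, q]) c y).
  have h : measurable_fun `[p, q]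
      (fun s => \int[mu]_(y in `[p, q]) c y - \int[mu]_(y in `[p, s]) c y).
    apply: measurable_funB => //; apply: subspace_continuous_measurable_fun => //.
    exact: parameterized_integral_continuous.
  apply: eq_measurable_fun h => s; rewrite inE/= in_itv/= => /andP[ps sq].
  by rewrite (Rintegral_split ps sq (ci q)) addrC addKr.
rewrite -lee_fin; apply: le_trans (abs_Rintegral_le _ _) _ => //.
  by apply: measurable_funM => //; exact: measurable_funTS.
have k0 s : p <= s <= q -> 0 <= k s by move=> /Jk; exact: le_trans.
apply: le_trans (primitive_pair_cauchy_schwarz N0 B0 p0 fg mk k0 kB).
apply: ge0_le_integral => //.
- apply/measurable_EFinP; apply: measurableT_comp => //.
  by apply: measurable_funM => //; exact: measurable_funTS.
- apply/measurable_EFinP; apply: measurable_funM => //.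
  by apply: measurableT_comp => //; exact: measurable_funTS.
- move=> s; rewrite /= in_itv/= => spq; rewrite lee_fin normrM ler_wpM2l//.
  exact: Jk.
Qed.

(** No oscillation is used: [primitive_le] bounds [|f(s)|] almost everywhere by a multiple of
    [s^(a/2 - 1)], which is integrable at 0. *)
Lemma osc_segment_small a N f g x t theta q : 0 < a -> 0 < N -> 0 < q ->
  primitive_pair a N f g ->
  `|osc_segment a x t theta f 0 q| <= 2 * Num.sqrt a^-1 * N * q `^ (a / 2).
Proof.
move=> a0 N0 q0 fg; have [lf lg fgae _] := fg; have [mf _ _] := lf.
have lo := locally_integrable_osc a x t theta lf; have [mo _ _] := lo.
apply: Rintegral_from0_le => // d d0 dq; rewrite -lee_fin.
apply: le_trans (abs_Rintegral_le _ (measurable_funTS mo)) _ => //.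
pose M := a * (N * Num.sqrt a^-1).
have M0 : 0 <= M by rewrite /M !mulr_ge0 ?sqrtr_ge0 ?ltW.
apply: (@le_trans _ _ (\int[mu]_(s in `[d, q]) (M * s `^ (a / 2 - 1))%:E)%E).
  apply: ae_ge0_le_integral => //.
  - apply/measurable_EFinP; apply: measurableT_comp => //.
    exact: measurable_funTS.
  - by move=> s _; rewrite lee_fin mulr_ge0 ?powR_ge0.
  - apply/measurable_EFinP; apply: measurable_funM => //.
    by apply: measurable_funTS; exact: measurable_powR.
  - move: fgae; apply: filterS; first exact: (ae_filter_ringOfSetsType mu).
    move=> s hs; rewrite /= in_itv/= => /andP[ds sq].
    have s0 : 0 < s by exact: lt_le_trans ds.
    rewrite lee_fin normrM (@le_trans _ _ `|f s|)//.
      by rewrite ler_piMr// ler_norml cos_geN1 cos_le1.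
    rewrite -(ler_pM2l s0) (_ : s * `|f s| = `|s * f s|); last first.
      by rewrite normrM (gtr0_norm s0).
    rewrite hs//.
    rewrite normrM normrN (gtr0_norm a0) mulrCA mulr_powRB1// /M -mulrA ler_pM2l//.
    by rewrite -mulrA; exact: primitive_le fg.
under eq_integral do rewrite EFinM.
rewrite ge0_integralZl//; last 2 first.
- by apply/measurable_EFinP; apply: measurable_funTS; exact: measurable_powR.
- by move=> s _; rewrite lee_fin powR_ge0.
have a20 : a / 2 != 0 by rewrite gt_eqF// divr_gt0.
rewrite integral_powR// -EFinM lee_fin /M.
have -> : 2 * Num.sqrt a^-1 * N * q `^ (a / 2) =
  a * (N * Num.sqrt a^-1) * ((a / 2)^-1 * q `^ (a / 2)) by field; rewrite gt_eqF.
rewrite ler_wpM2l// ler_pM2l ?invr_gt0 ?divr_gt0//.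
by rewrite lerBlDr lerDl powR_ge0.
Qed.

End HalfLine.

(** * Uniform decay and convergence of the half-line integrals *)

Section HalfLineDecay.
Context {R : realType}.
Local Notation mu := (@lebesgue_measure R).
Implicit Types (f g : R -> R) (a N x t theta p q : R).

Lemma ler_powR_base (r u w : R) : 0 <= r -> 0 < u -> u <= w ->
  u `^ r <= w `^ r.
Proof.
move=> r0 u0 uw; apply: ge0_ler_powR; rewrite ?nnegrE ?(ltW u0)//.
exact: le_trans (ltW u0) uw.
Qed.

(** With the kernel bounded by a multiple of [1 / (t s^a)], both terms of [osc_segment_le] have
    order [p^(- a/2) / t]: the first as [p^(a/2) p^(- a)], the second as the square root of the
    integral of [s^(a - 1) s^(- 2 a)]. The 2 in the constant counts them. *)
Lemma osc_segment_far a c : 0 < a -> 0 < c ->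
  exists2 C, 0 < C & forall f g N x t theta p q, 0 < N -> 0 < t -> 0 < p ->
    p <= q -> primitive_pair a N f g ->
    (forall y, p <= y <= q -> c * t * y `^ a <= `|phase_euler a x t y|) ->
    `|osc_segment a x t theta f p q| <= C * N / t * p `^ (- (a / 2)).
Proof.
move=> a0 c0; pose Cf := 2 / c + (1 + a * `|a - 1| / c) / (a * c).
have Cf0 : 0 < Cf by rewrite /Cf; pos.
pose K := Num.sqrt a^-1.
have K0 : 0 < K by rewrite sqrtr_gt0 invr_gt0.
exists (2 * a * K * Cf); first by pos.
move=> f g N x t theta p q N0 t0 p0 pq fg hc.
have q0 : 0 < q by exact: lt_le_trans pq.
pose k s := Cf / t * s `^ (- a).
pose B := Cf / t * (K * p `^ (- (a / 2))).
have B0 : 0 < B by rewrite /B; pos.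
have mk : measurable_fun `[p, q] k.
  by apply: measurable_funTS; apply: measurable_funM => //; exact: measurable_powR.
have Jk s : p <= s <= q -> `|osc_integral a x t theta s q| <= k s.
  move=> /andP[ps sq]; have s0 : 0 < s by exact: lt_le_trans ps.
  have := @osc_integral_far R a x t theta s q c a0 t0 c0 s0 sq.
  have -> : k s = Cf / (t * s `^ a) by rewrite /k powRN invfM mulrA.
  apply => y /andP[sy yq].
  by apply: hc; rewrite (le_trans ps sy).
have kB : (\int[mu]_(s in `[p, q]) (s `^ (a - 1) * k s ^+ 2)%:E <=
    (B ^+ 2)%:E)%E.
  have -> : (\int[mu]_(s in `[p, q]) (s `^ (a - 1) * k s ^+ 2)%:E =
      \int[mu]_(s in `[p, q]) (((Cf / t) ^+ 2)%:E * (s `^ (- a - 1))%:E))%E.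
    apply: eq_integral => s; rewrite inE/= in_itv/= => /andP[ps _].
    have s0 : 0 < s by exact: lt_le_trans ps.
    have -> : s `^ (- a - 1) = s `^ (a - 1) * s `^ (- a) ^+ 2.
      by rewrite expr2 -!powRD ?(gt_eqF s0) ?implybT//; congr (_ `^ _); ring.
    by rewrite -EFinM /k exprMn mulrCA.
  rewrite ge0_integralZl//; last 3 first.
  - by apply/measurable_EFinP; apply: measurable_funTS; exact: measurable_powR.
  - by move=> s _; rewrite lee_fin powR_ge0.
  - by rewrite lee_fin sqr_ge0.
  rewrite integral_powR//; last by rewrite oppr_eq0 gt_eqF.
  rewrite -EFinM lee_fin /B !exprMn ler_pM2l; last by pos.
  rewrite /K sqr_sqrtr; last by rewrite invr_ge0 ltW.
  have -> : - (a / 2) = (- a) / 2 by ring.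
  rewrite powR_half_sqr invrN mulNr -mulrN opprB ler_pM2l ?invr_gt0//.
  by rewrite lerBlDr lerDl powR_ge0.
apply: le_trans (osc_segment_le a0 N0 B0 p0 pq fg mk Jk kB) _.
rewrite le_eqVlt; apply/orP; left; apply/eqP.
have -> : p `^ (- (a / 2)) = p `^ (a / 2) * p `^ (- a).
  by rewrite -powRD ?(gt_eqF p0) ?implybT//; congr (_ `^ _); field.
by rewrite /B /k -/K (_ : p `^ (- (a / 2)) = p `^ (a / 2) * p `^ (- a));
  [ring|rewrite -powRD ?(gt_eqF p0) ?implybT//; congr (_ `^ _); field].
Qed.

Lemma sqrtr_powR (v a : R) : Num.sqrt (v `^ a) = v `^ (a / 2).
Proof. by rewrite -powR_half_sqr sqrtr_sqr ger0_norm ?powR_ge0. Qed.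

(** The kernel is bounded by a constant multiple of [(t v^a)^(- 1/2)], and the weights contribute at
    most [(2 v)^(a/2)]. The powers of [v] cancel, so the bound does not depend on the position of
    the stationary point. *)
Lemma osc_segment_near a : 0 < a -> a != 1 ->
  exists2 C, 0 < C & forall f g N t v theta p q, 0 < N -> 0 < t -> 0 < v ->
    v / 2 <= p -> p <= q -> q <= 2 * v -> primitive_pair a N f g ->
    `|osc_segment a (- (a * t * v `^ (a - 1))) t theta f p q| <=
      C * N / Num.sqrt t.
Proof.
move=> a0 a1; have [Cn Cn0 hCn] := @osc_integral_near R a a0 a1.
pose K := Num.sqrt a^-1.
have K0 : 0 < K by rewrite sqrtr_gt0 invr_gt0.
exists (2 * a * K * Cn * 2 `^ (a / 2)); first by pos.
move=> f g N t v theta p q N0 t0 v0 vp pq qv fg.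
have p0 : 0 < p by rewrite (lt_le_trans _ vp)// divr_gt0.
have s0 : 0 < Num.sqrt (t * v `^ a) by rewrite sqrtr_gt0; pos.
pose kk := Cn / Num.sqrt (t * v `^ a).
have kk0 : 0 < kk by rewrite /kk divr_gt0.
pose B := kk * (K * (2 * v) `^ (a / 2)).
have v20 : 0 < 2 * v by pos.
have B0 : 0 < B by rewrite /B; pos.
have Jk s : p <= s <= q ->
    `|osc_integral a (- (a * t * v `^ (a - 1))) t theta s q| <= cst kk s.
  move=> /andP[ps sq]; apply: hCn => //; exact: le_trans ps.
have kB : (\int[mu]_(s in `[p, q]) (s `^ (a - 1) * cst kk s ^+ 2)%:E <=
    (B ^+ 2)%:E)%E.
  under eq_integral do rewrite /= mulrC EFinM.
  rewrite ge0_integralZl//; last 3 first.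
  - by apply/measurable_EFinP; apply: measurable_funTS; exact: measurable_powR.
  - by move=> s _; rewrite lee_fin powR_ge0.
  - by rewrite lee_fin sqr_ge0.
  rewrite integral_powR ?gt_eqF//.
  rewrite -EFinM lee_fin /B !exprMn ler_pM2l; last by pos.
  rewrite /K sqr_sqrtr; last by rewrite invr_ge0 ltW.
  rewrite powR_half_sqr ler_pM2l ?invr_gt0//.
  apply: (@le_trans _ _ (q `^ a)); first by rewrite lerBlDr lerDl powR_ge0.
  by apply: ler_powR_base => //; [exact: ltW|exact: lt_le_trans pq].
have mk : measurable_fun `[p, q] (cst kk) by exact: measurable_cst.
apply: le_trans (osc_segment_le a0 N0 B0 p0 pq fg mk Jk kB) _.
have hB : kk * (2 * v) `^ (a / 2) = Cn * 2 `^ (a / 2) / Num.sqrt t.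
  rewrite /kk powRM ?ltW// sqrtrM ?ltW// sqrtr_powR.
  have vv : v `^ (a / 2) != 0 by rewrite gt_eqF// powR_gt0.
  have st : Num.sqrt t != 0 by rewrite gt_eqF// sqrtr_gt0.
  by field; rewrite vv st.
have pv : p `^ (a / 2) <= (2 * v) `^ (a / 2).
  by apply: ler_powR_base => //; [pos|exact: le_trans pq qv].
apply: (@le_trans _ _ (a * (N * (K * (2 * v) `^ (a / 2))) * kk + a * (N * B))).
  rewrite lerD2r ler_pM2r// ler_pM2l// ler_pM2l// ler_pM2l//.
rewrite /B [leLHS](_ : _ = 2 * a * N * K * (kk * (2 * v) `^ (a / 2))); last by ring.
rewrite hB le_eqVlt; apply/orP; left; apply/eqP; ring.
Qed.

(** An additive function of segments is bounded by treating the two sides of a cut [w] separately,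
    wherever the segment lies. Two uses, at [v / 2] and at [2 v], isolate the dyadic block of
    [v]. *)
Lemma split_bound (F : R -> R -> R) (p0 w K1 K2 : R) :
  (forall p m q, p0 <= p -> p <= m -> m <= q -> F p q = F p m + F m q) ->
  0 <= K1 -> 0 <= K2 ->
  (forall p q, p0 <= p -> p <= q -> q <= w -> `|F p q| <= K1) ->
  (forall p q, p0 <= p -> w <= p -> p <= q -> `|F p q| <= K2) ->
  forall p q, p0 <= p -> p <= q -> `|F p q| <= K1 + K2.
Proof.
move=> Fadd K10 K20 F1 F2 p q p0p pq.
have [qw|wq] := leP q w; first by rewrite (le_trans (F1 _ _ p0p pq qw))// lerDl.
have [wp|pw] := leP w p; first by rewrite (le_trans (F2 _ _ p0p wp pq))// lerDr.
rewrite (Fadd p w q p0p (ltW pw) (ltW wq)) (le_trans (ler_normD _ _))// lerD//.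
  by apply: F1 => //; exact: ltW.
by apply: F2 => //; [exact: le_trans (ltW pw)|exact: ltW].
Qed.

Lemma stationary_point a x t : 0 < a -> a != 1 -> 0 < t -> x < 0 ->
  exists2 v, 0 < v & x = - (a * t * v `^ (a - 1)).
Proof.
move=> a0 a1 t0 x0.
have y0 : 0 < - x / (a * t) by rewrite divr_gt0 ?oppr_gt0 ?mulr_gt0.
exists ((- x / (a * t)) `^ (a - 1)^-1); first exact: powR_gt0.
rewrite -powRrM mulVf ?subr_eq0// powRr1 ?ltW//.
by field; rewrite !gt_eqF.
Qed.

(** The first bound carries the decay in time. The second is a tail estimate for the convergence as
    [r] tends to infinity: its threshold [r0] may depend on [x] and [t], whereas [C] depends on [a]
    alone. *)
Lemma osc_segment_bounds a : 0 < a -> a != 1 ->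
  exists2 C, 0 < C & forall f g N x t theta, 0 < N -> 0 < t ->
    primitive_pair a N f g ->
    (forall r, 0 <= r -> `|osc_segment a x t theta f 0 r| <= C * N / Num.sqrt t) /\
    (exists2 r0, 0 < r0 & forall p q, r0 <= p -> p <= q ->
      `|osc_segment a x t theta f p q| <= C * N / t * p `^ (- (a / 2))).
Proof.
move=> a0 a1; pose c := a * (1 - 2 `^ (- `|a - 1|)) : R.
have c0 : 0 < c by exact: powR_gap_gt0.
(* This lets the far estimate with the same [c] serve also when there is no stationary point. *)
have ca : c <= a by rewrite ler_piMr ?ltW// lerBlDr lerDl powR_ge0.
have [Cf Cf0 far] := osc_segment_far a0 c0.
have [Cn Cn0 near] := osc_segment_near a0 a1.
pose K := Num.sqrt a^-1 : R.
have K0 : 0 < K by rewrite sqrtr_gt0 invr_gt0.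
pose C := 2 * K + (Cf + (Cn + Cf)).
have CC : Cf <= C by rewrite /C; lra.
have C0 : 0 < C by rewrite /C; pos.
exists C => // f g N x t theta N0 t0 fg.
have [lf _ _ _] := fg.
have lo := locally_integrable_osc a x t theta lf.
have st0 : 0 < Num.sqrt t by rewrite sqrtr_gt0.
pose S := osc_segment a x t theta f.
have Sadd p m q : p <= m -> m <= q -> S p q = S p m + S m q.
  by move=> pm mq; apply: Rintegral_split => //; exact: locally_integrable_segment.
(* At this scale [s^(a/2) = t^(- 1/2)], so the absolute estimate below [s] and the oscillatory one
   above it are of the same size. *)
pose s := t `^ (- a^-1); have s0 : 0 < s by exact: powR_gt0.
have sa : s `^ (a / 2) = (Num.sqrt t)^-1.
  rewrite /s -powRrM -(powR12_sqrt (ltW t0)) -powRN; congr (_ `^ _).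
  by field; rewrite gt_eqF.
have tail p : s <= p -> N / t * p `^ (- (a / 2)) <= N / Num.sqrt t.
  move=> sp; have p0 : 0 < p by exact: lt_le_trans sp.
  rewrite -mulrA ler_pM2l// mulrC powRN ler_pdivrMr// -{2}(sqr_sqrtr (ltW t0)).
  rewrite expr2 mulrA mulVf ?gt_eqF// mul1r -[leRHS]invrK -sa.
  rewrite lef_pV2 ?posrE ?powR_gt0//.
  by apply: ler_powR_base => //; pos.
have large_small : (forall p q, s <= p -> p <= q ->
      `|S p q| <= (Cf + (Cn + Cf)) * (N / Num.sqrt t)) ->
    forall r, 0 <= r -> `|S 0 r| <= C * N / Num.sqrt t.
  move=> large r r0.
  have small q : 0 <= q -> q <= s -> `|S 0 q| <= 2 * K * (N / Num.sqrt t).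
    rewrite le_eqVlt => /predU1P[<- _|q0 qs].
      rewrite /S /osc_segment set_itv1 Rintegral_set1 normr0.
      by pos.
    apply: le_trans (osc_segment_small x t theta a0 N0 q0 fg) _.
    rewrite -/K -(mulrA _ N) ler_pM2l; last by pos.
    rewrite ler_pM2l//.
    by rewrite -sa; apply: ler_powR_base => //; pos.
  rewrite -mulrA /C mulrDl.
  have [rs|sr] := leP r s.
    rewrite (le_trans (small r r0 rs))// lerDl; pos.
  rewrite (Sadd 0 s r (ltW s0) (ltW sr)) (le_trans (ler_normD _ _))//.
  by apply: lerD; [exact: small (ltW s0) _|exact: large (ltW sr)].
(* For [0 <= x] both terms of [phase_euler] are nonnegative and the whole half line is far; for
   [x < 0] the terms cancel at exactly one positive point. *)
have [x0|x0] := leP 0 x.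
- have hfar p q : 0 < p -> p <= q -> `|S p q| <= Cf * N / t * p `^ (- (a / 2)).
    move=> p0 pq; apply: far fg _ => // y /andP[py _].
    have y0 : 0 < y by exact: lt_le_trans py.
    rewrite ger0_norm /phase_euler; last by rewrite addr_ge0 ?mulr_ge0 ?powR_ge0 ?(ltW y0) ?(ltW t0) ?(ltW a0).
    have h : c * t * y `^ a <= a * t * y `^ a.
      by rewrite ler_pM2r ?powR_gt0// ler_pM2r.
    by rewrite (le_trans h)// lerDr mulr_ge0 ?(ltW y0).
  split.
  + apply: large_small => p q sp pq.
    have p0 : 0 < p by exact: lt_le_trans sp.
    apply: (le_trans (hfar p q p0 pq)); rewrite -!mulrA (mulrA N).
    apply: (@le_trans _ _ (Cf * (N / Num.sqrt t))).
      by rewrite ler_pM2l//; exact: tail.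
    rewrite ler_wpM2r//; first by pos.
    by rewrite lerDl; pos.
  + exists 1 => // p q p1 pq; have p0 : 0 < p by exact: lt_le_trans p1.
    apply: (le_trans (hfar p q p0 pq)); rewrite -!mulrA ler_wpM2r//.
    by pos.
- have [v v0 xE] := stationary_point a0 a1 t0 x0.
  have hfar p q : 0 < p -> p <= q ->
      (q <= v / 2) || (2 * v <= p) ->
      `|S p q| <= Cf * N / t * p `^ (- (a / 2)).
    move=> p0 pq hv; apply: far fg _ => // y /andP[py yq].
    have y0 : 0 < y by exact: lt_le_trans py.
    rewrite xE; apply: phase_euler_far => //.
    case/orP : hv => h; apply/orP; [left|right]; [exact: le_trans h|exact: le_trans py].
  have hfar' p q : s <= p -> p <= q -> (q <= v / 2) || (2 * v <= p) ->
      `|S p q| <= Cf * (N / Num.sqrt t).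
    move=> sp pq hv; have p0 : 0 < p by exact: lt_le_trans sp.
    apply: (le_trans (hfar p q p0 pq hv)); rewrite -!mulrA (mulrA N).
    by rewrite ler_pM2l//; exact: tail.
  split.
  + apply: large_small; rewrite mulrDl mulrDl.
    apply: (@split_bound _ s (v / 2)).
    * by move=> p m q _; exact: Sadd.
    * by pos.
    * by pos.
    * by move=> p q sp pq qv; apply: hfar' => //; rewrite qv.
    * move=> p q sp vp pq.
      (* The maximum keeps both constraints: [v / 2] for the estimate near [v], and [s] for the tail
         beyond [2 v]. *)
      apply: (@split_bound S (Num.max s (v / 2)) (2 * v)) pq.
      - by move=> p1 m q1 _; exact: Sadd.
      - by pos.
      - by pos.
      - move=> p1 q1; rewrite ge_max => /andP[_ vp1] pq1 qv1.
        by rewrite /S xE mulrA; exact: near fg.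
      - move=> p1 q1; rewrite ge_max => /andP[sp1 _] vp1 pq1.
        by apply: hfar' => //; rewrite vp1 orbT.
      - by rewrite ge_max sp vp.
  + exists (2 * v); first by pos.
    move=> p q vp pq; have p0 : 0 < p by rewrite (lt_le_trans _ vp)//; pos.
    apply: (le_trans (hfar p q p0 pq _)); first by rewrite vp orbT.
    by rewrite -!mulrA ler_wpM2r//; pos.
Qed.

Lemma osc_segment_cvg a : 0 < a -> a != 1 ->
  exists2 C, 0 < C & forall f g N x t theta, 0 < N -> 0 < t ->
    primitive_pair a N f g ->
    cvg (osc_segment a x t theta f 0 r @[r --> +oo]) /\
    (forall r, 0 <= r -> `|osc_segment a x t theta f 0 r| <= C * N / Num.sqrt t).
Proof.
move=> a0 a1; have [C C0 hC] := osc_segment_bounds a0 a1.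
exists C => // f g N x t theta N0 t0 fg.
have [hS [r0 r00 hr0]] := hC f g N x t theta N0 t0 fg.
split => //.
have [lf _ _ _] := fg.
have lo := locally_integrable_osc a x t theta lf.
apply/cauchy_cvgP/cauchy_exP => e e0.
(* Chosen so that [r1^(a/2) >= X] makes the tail bound at most [e / 2]; the factor 2 provides the
   strict inequality. *)
pose X := (2 * C * N / (e * t)).
have X0 : 0 < X by rewrite /X; pos.
pose r1 := Num.max r0 (X `^ (2 / a)).
have r01 : r0 <= r1 by rewrite le_max lexx.
have Xr1 : X `^ (2 / a) <= r1 by rewrite le_max lexx orbT.
have r10 : 0 < r1 by exact: lt_le_trans r01.
exists (osc_segment a x t theta f 0 r1); exists r1; split; first exact: num_real.
move=> r /ltW r1r; rewrite /ball/=.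
rewrite {2}/osc_segment (Rintegral_split (ltW r10) r1r); last first.
  exact: locally_integrable_segment.
rewrite -/(osc_segment a x t theta f 0 r1) opprD addrA subrr sub0r normrN.
apply: le_lt_trans (hr0 r1 r r01 r1r) _.
have h : X <= r1 `^ (a / 2).
  have -> : X = (X `^ (2 / a)) `^ (a / 2).
    rewrite -powRrM (_ : 2 / a * (a / 2) = 1) ?powRr1 ?(ltW X0)//.
    by field; rewrite gt_eqF.
  by apply: ler_powR_base => //; [pos|exact: powR_gt0].
have rp : 0 < r1 `^ (a / 2) by exact: powR_gt0.
rewrite powRN ltr_pdivrMr//.
apply: (@lt_le_trans _ _ (e * X)); last by rewrite ler_pM2l.
rewrite /X.
have -> : e * (2 * C * N / (e * t)) = 2 * (C * N / t).
  by field; rewrite !gt_eqF.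
by rewrite ltr_pMl ?ltr1n//; pos.
Qed.

End HalfLineDecay.

(** * From the half line to the line *)

Section Reflection.
Context {R : realType}.
Local Notation mu := (@lebesgue_measure R).
Implicit Types f g : R -> R.

Lemma measurable_oppR : measurable_fun setT (-%R : measurableTypeR R -> measurableTypeR R).
Proof. exact: oppr_measurable. Qed.

Lemma ge0_integral_oppr (D : set R) (f : R -> \bar R) : measurable D ->
  measurable_fun setT f -> (forall x, 0 <= f x)%E ->
  (\int[mu]_(x in D) f x = \int[mu]_(x in -%R @^-1` D) f (- x)%R)%E.
Proof.
move=> mD mf f0.
rewrite -[RHS](@ge0_integral_pushforward _ _ _ _ R _ measurable_oppR mu D f)//.
- by apply: eq_measure_integral => //= A mA _; exact/esym/lebesgue_measureN.
- exact: measurable_funS mf.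
Qed.

Lemma integral_oppr (D : set R) (f : R -> \bar R) : measurable D ->
  measurable_fun setT f ->
  (\int[mu]_(x in D) f x = \int[mu]_(x in -%R @^-1` D) f (- x)%R)%E.
Proof.
move=> mD mf; rewrite integralE [RHS]integralE.
rewrite (ge0_integral_oppr mD (measurable_funepos mf) (funepos_ge0 _)).
rewrite (ge0_integral_oppr mD (measurable_funeneg mf) (funeneg_ge0 _)).
congr (_ - _)%E; apply: eq_integral => x _; first by rewrite !funeposE.
by rewrite !funenegE.
Qed.

Lemma Rintegral_oppr (D : set R) f : measurable D -> measurable_fun setT f ->
  \int[mu]_(x in D) f x = \int[mu]_(x in -%R @^-1` D) f (- x).
Proof.
move=> mD mf; rewrite /Rintegral (@integral_oppr D (EFin \o f))//.
exact/measurable_EFinP.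
Qed.

Lemma locally_integrable_oppr f : locally_integrable setT f ->
  locally_integrable setT (fun x => f (- x)).
Proof.
move=> [mf oT fi].
have mfN : measurable_fun setT (fun x : R => f (- x)).
  by apply: (measurableT_comp mf); exact: measurable_oppR.
split => // K _ cK.
have cNK : compact (-%R @` K).
  apply: continuous_compact => //; apply: continuous_subspaceT.
  exact: opp_continuous.
apply: le_lt_trans (fi (-%R @` K) _ cNK) => //.
rewrite [leRHS]ge0_integral_oppr//; last 2 first.
- exact: compact_measurable.
- by apply/measurable_EFinP; exact: measurableT_comp.
have KE : -%R @^-1` (-%R @` K) = K.
  apply/seteqP; split => [x /= [y Ky /oppr_inj <-]//|x Kx /=].
  by exists x.
by rewrite KE.
Qed.

Lemma smooth_oppr (p : R -> R) : smooth p -> smooth (fun x => p (- x)).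
Proof.
move=> sp; have := smooth_comp sp (@smooth_affine R (-1) 0).
by congr smooth; apply/funext => x /=; rewrite mulN1r addr0.
Qed.

Lemma derive1_oppr (p : R -> R) : smooth p ->
  derive1 (fun x => p (- x)) = fun x => - derive1 p (- x).
Proof.
move=> sp; apply: is_derive_derive1 => x.
have hN : is_derive x (1:R) (fun u : R => - u) (-1) by exact: is_deriveNid.
have := is_derive1_comp (smooth_is_derive sp (- x)) hN.
by rewrite mulrN1.
Qed.

(** The Euler operator [x d/dx] commutes with the reflection [x -> - x], so negative frequencies
    obey the same weak identity. *)
Lemma weak_euler_oppr a f g : locally_integrable setT f ->
  locally_integrable setT g -> weak_euler a f g ->
  weak_euler a (fun x => f (- x)) (fun x => g (- x)).
Proof.
move=> [mf _ _] [mg _ _] fg M p sp pM.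
have sq := smooth_oppr sp.
have qM : vanishes_outside M (fun x => p (- x)).
  by move=> x Mx; apply: pM; rewrite normrN.
have mp : measurable_fun setT p := smooth_measurable sp.
have mp' : measurable_fun setT (derive1 p) := smooth_measurable (smooth_derive1 sp).
have m1 : measurable_fun setT (fun x : R => g (- x) * p x).
  apply: measurable_funM => //.
  by apply: (measurableT_comp mg); exact: measurable_oppR.
have m2 : measurable_fun setT (fun x : R => f (- x) * (x * derive1 p x)).
  apply: measurable_funM; last exact: measurable_funM.
  by apply: (measurableT_comp mf); exact: measurable_oppR.
rewrite (Rintegral_oppr (@measurableT _ _) m1) (Rintegral_oppr (@measurableT _ _) m2).
rewrite preimage_setT.
have -> : (fun x : R => g (- - x) * p (- x)) = (fun x => g x * p (- x)).
  by apply/funext => x; rewrite opprK.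
rewrite (fg M _ sq qM); apply: (congr1 ( *%R a^-1)); apply: eq_Rintegral => x _.
by rewrite (derive1_oppr sp) opprK; ring.
Qed.

End Reflection.

(** * Negative frequencies, real and imaginary parts, and conclusion *)

Section Assembly.
Local Open Scope complex_scope.
Context {R : realType}.
Local Notation mu := (@lebesgue_measure R).

Lemma cabs_sqr (z : R[i]) : cabs z ^+ 2 = complex.Re z ^+ 2 + complex.Im z ^+ 2.
Proof.
by rewrite /cabs normc_def/= sqr_sqrtr// addr_ge0 ?sqr_ge0.
Qed.

Lemma cabs_le (x y : R) : cabs (x +i* y) <= `|x| + `|y|.
Proof.
have h : 0 <= `|x| + `|y| by rewrite addr_ge0.
have c0 : 0 <= cabs (x +i* y) by rewrite /cabs normc_def/= sqrtr_ge0.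
rewrite -(@ler_pXn2r _ 2)// ?nnegrE// cabs_sqr/=.
rewrite -(real_normK (num_real x)) -(real_normK (num_real y)) sqrrD.
by rewrite addrAC lerDl mulrn_wge0// mulr_ge0.
Qed.

Lemma dist_fourier_density (T : functional R) :
  (exists f, fourier_density T f) -> fourier_density T (dist_fourier T).
Proof. by move=> [f Tf]; exact: (xgetPex (fun=> 0) (ex_intro _ f Tf)). Qed.

(** The factor [a^-1] and the test functions are real, so the complex identity separates into its
    real and imaginary parts. *)
Lemma scaling_field_weak_euler a T (f g : R -> R[i]) :
  fourier_density T f -> fourier_density (scaling_field a T) g ->
  weak_euler a (fun x => complex.Re (f x)) (fun x => complex.Re (g x)) /\
  weak_euler a (fun x => complex.Im (f x)) (fun x => complex.Im (g x)).
Proof.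
move=> Tf Tg; split => M p sp pM;
  have := scaling_field_density Tf Tg sp pM; rewrite /cintegral => E.
- have := congr1 (@complex.Re R) E; rewrite /= mul0r subr0 => E1.
  rewrite [LHS](_ : _ = \int[mu]_x complex.Re (g x * (p x)%:C)); last first.
    by apply: eq_Rintegral => x _; case: (g x) => u v /=; rewrite mulr0 subr0.
  rewrite E1; congr (_ * _); apply: eq_Rintegral => x _.
  by case: (f x) => u v /=; rewrite mulr0 subr0.
- have := congr1 (@complex.Im R) E; rewrite /= mul0r addr0 => E1.
  rewrite [LHS](_ : _ = \int[mu]_x complex.Im (g x * (p x)%:C)); last first.
    by apply: eq_Rintegral => x _; case: (g x) => u v /=; rewrite mulr0 add0r.
  rewrite E1; congr (_ * _); apply: eq_Rintegral => x _.
  by case: (f x) => u v /=; rewrite mulr0 add0r.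
Qed.

Lemma primitive_pair_of_weak_euler a (N : R) (f g : R -> R) : a != 0 ->
  locally_integrable setT f -> locally_integrable setT g -> weak_euler a f g ->
  (\int[mu]_x (`|x| `^ (1 - a) * g x ^+ 2)%:E <= (N ^+ 2)%:E)%E ->
  primitive_pair a N f g.
Proof.
move=> a0 lf lg fg gN; have [mg _ _] := lg.
split; [exact: lf | exact: lg | exact: weak_euler_ae | ].
have mE : measurable_fun setT (fun x : R => (`|x| `^ (1 - a) * g x ^+ 2)%:E).
  apply/measurable_EFinP; apply: measurable_funM; last exact: measurable_funX.
  by apply: (measurableT_comp (@measurable_powR _ _)).
apply: le_trans gN.
apply: (@le_trans _ _ (\int[mu]_(x in `]0%R, +oo[) (`|x| `^ (1 - a) * g x ^+ 2)%:E)%E).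
  rewrite le_eqVlt; apply/orP; left; apply/eqP; apply: eq_integral => x.
  by rewrite inE/= in_itv/= andbT => x0; rewrite gtr0_norm.
apply: ge0_subset_integral => // x _.
by rewrite lee_fin mulr_ge0 ?powR_ge0 ?sqr_ge0.
Qed.

Lemma primitive_pair_oppr a (N : R) (f g : R -> R) : a != 0 ->
  locally_integrable setT f -> locally_integrable setT g -> weak_euler a f g ->
  (\int[mu]_x (`|x| `^ (1 - a) * g x ^+ 2)%:E <= (N ^+ 2)%:E)%E ->
  primitive_pair a N (fun x => f (- x)) (fun x => g (- x)).
Proof.
move=> a0 lf lg fg gN; have [mg _ _] := lg.
apply: primitive_pair_of_weak_euler => //.
- exact: locally_integrable_oppr.
- exact: locally_integrable_oppr.
- exact: weak_euler_oppr.
- apply: le_trans gN.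
  have mE : measurable_fun [set: R] (fun x : R => (`|x| `^ (1 - a) * g x ^+ 2)%:E).
    apply/measurable_EFinP; apply: measurable_funM; last exact: measurable_funX.
    by apply: (measurableT_comp (@measurable_powR _ _)).
  have E0 (x : R) : (0 <= (`|x| `^ (1 - a) * g x ^+ 2)%:E)%E.
    by rewrite lee_fin mulr_ge0 ?powR_ge0 ?sqr_ge0.
  rewrite (ge0_integral_oppr (@measurableT _ _) mE E0) preimage_setT.
  rewrite le_eqVlt; apply/orP; left; apply/eqP.
  by apply: eq_integral => x _; rewrite normrN.
Qed.

(** The common form of the four real integrals that make up [truncated_solution]: two shifts
    [theta], and the real or imaginary part of the density as [f]. *)
Definition symmetric_osc (a x t theta : R) (f : R -> R) (r : R) : R :=
  \int[mu]_(y in `[- r, r]) (f y * cos (x * y + t * `|y| `^ a + theta)).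

Lemma locally_integrable_symmetric a x t theta (f : R -> R) :
  locally_integrable setT f -> locally_integrable setT
    (fun y => f y * cos (x * y + t * `|y| `^ a + theta)).
Proof.
move=> [mf oT fi].
have mc : measurable_fun setT (fun y : R => cos (x * y + t * `|y| `^ a + theta)).
  apply: measurableT_comp; first exact: continuous_measurable_fun (@continuous_cos R).
  apply: measurable_funD => //; apply: measurable_funD; first exact: measurable_funM.
  apply: measurable_funM => //.
  by apply: (measurableT_comp (@measurable_powR _ _)).
split => //; first exact: measurable_funM.
move=> K KT cK; apply: le_lt_trans (fi K KT cK).
have mK := compact_measurable cK.
apply: ge0_le_integral => //.
- apply/measurable_EFinP; apply: measurableT_comp => //.
  by apply: measurable_funTS; exact: measurable_funM.
- by apply/measurable_EFinP; apply: measurableT_comp => //; exact: measurable_funTS.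
- move=> y _; rewrite lee_fin normrM ler_piMr//.
  by rewrite ler_norml cos_geN1 cos_le1.
Qed.

(** The term [|y|^a] is even, so reflecting the negative half changes only the sign of [x] and the
    argument of [f]. *)
Lemma symmetric_oscE a x t theta (f : R -> R) (r : R) : 0 <= r ->
  locally_integrable setT f ->
  symmetric_osc a x t theta f r =
    osc_segment a x t theta f 0 r +
    osc_segment a (- x) t theta (fun y => f (- y)) 0 r.
Proof.
move=> r0 lf; have lo := locally_integrable_symmetric a x t theta lf.
have [mo _ _] := lo.
have Nr0 : - r <= 0 by rewrite oppr_le0.
have mI : measurable `[- r, 0]%classic by exact: measurable_itv.
rewrite /symmetric_osc (Rintegral_split Nr0 r0); last first.
  exact: locally_integrable_segment lo.
rewrite (Rintegral_oppr mI mo) opp_preimage_itvbndbnd/= oppr0 opprK.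
rewrite [LHS]addrC /osc_segment.
have -> : \int[mu]_(y in `[0, r]) (f y * cos (x * y + t * `|y| `^ a + theta)) =
    \int[mu]_(y in `[0, r]) (f y * cos (phase a x t theta y)).
  apply: eq_Rintegral => y; rewrite inE/= in_itv/= => /andP[y0 _].
  by rewrite ger0_norm.
have -> : \int[mu]_(y in `[0, r])
      (f (- y) * cos (x * - y + t * `|- y| `^ a + theta)) =
    \int[mu]_(y in `[0, r]) (f (- y) * cos (phase a (- x) t theta y)).
  apply: eq_Rintegral => y; rewrite inE/= in_itv/= => /andP[y0 _].
  by rewrite normrN ger0_norm// /phase mulrN mulNr.
by [].
Qed.

Lemma symmetric_osc_cvg a : 0 < a -> a != 1 ->
  exists2 C, 0 < C & forall f g N x t theta, 0 < N -> 0 < t ->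
    locally_integrable setT f -> locally_integrable setT g -> weak_euler a f g ->
    (\int[mu]_x (`|x| `^ (1 - a) * g x ^+ 2)%:E <= (N ^+ 2)%:E)%E ->
    exists2 l : R, symmetric_osc a x t theta f r @[r --> +oo] --> l &
      `|l| <= C * N / Num.sqrt t.
Proof.
move=> a0 a1; have [C C0 hC] := osc_segment_cvg a0 a1.
(* One [C] for each half line. *)
exists (2 * C); first by pos.
move=> f g N x t theta N0 t0 lf lg fg gN.
have an0 : a != 0 by rewrite gt_eqF.
have [cp bp] := hC _ _ N x t theta N0 t0
  (primitive_pair_of_weak_euler an0 lf lg fg gN).
have [cn bn] := hC _ _ N (- x) t theta N0 t0
  (primitive_pair_oppr an0 lf lg fg gN).
have cS : osc_segment a x t theta f 0 r +
    osc_segment a (- x) t theta (fun y => f (- y)) 0 r @[r --> +oo] -->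
    lim (osc_segment a x t theta f 0 r @[r --> +oo]) +
    lim (osc_segment a (- x) t theta (fun y => f (- y)) 0 r @[r --> +oo]).
  exact: cvgD cp cn.
set l := _ + _ in cS.
have r0near : \forall r \near +oo, (0:R) <= r by exact: nbhs_pinfty_ge.
exists l.
  apply: cvg_trans cS; apply: near_eq_cvg.
  by apply: filterS r0near => r r0; rewrite symmetric_oscE.
have limB (h : R -> R) : cvg (h r @[r --> +oo]) ->
    (forall r : R, 0 <= r -> `|h r| <= C * N / Num.sqrt t) ->
    `|lim (h r @[r --> +oo])| <= C * N / Num.sqrt t.
  move=> ch hb; rewrite ler_norml; apply/andP; split.
  - apply: limr_ge => //; apply: filterS r0near => r /hb.
    by rewrite ler_norml => /andP[].
  - apply: limr_le => //; apply: filterS r0near => r /hb.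
    by rewrite ler_norml => /andP[].
rewrite /l (le_trans (ler_normD _ _))//.
have := limB _ cp bp; have := limB _ cn bn.
by set u := C * N / _; rewrite (_ : 2 * C * N / _ = u + u); [lra|rewrite /u; ring].
Qed.

Lemma truncated_solutionE a T t x r :
  clocally_integrable (dist_fourier T) ->
  let A y := complex.Re (dist_fourier T y) in
  let B y := complex.Im (dist_fourier T y) in
  complex.Re (truncated_solution a T t x r) =
    symmetric_osc a x t 0 A r - symmetric_osc a x t (- (pi / 2)) B r /\
  complex.Im (truncated_solution a T t x r) =
    symmetric_osc a x t 0 B r + symmetric_osc a x t (- (pi / 2)) A r.
Proof.
move=> [lA lB] A B.
have iA theta := locally_integrable_segment (- r) r
  (locally_integrable_symmetric a x t theta lA).
have iB theta := locally_integrable_segment (- r) r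
  (locally_integrable_symmetric a x t theta lB).
rewrite /truncated_solution /cintegral/= /symmetric_osc; split.
- rewrite -RintegralB//.
  apply: eq_Rintegral => y _; rewrite /propagator_fourier /A /B /expi.
  case: (dist_fourier T y) => u v /=.
  by rewrite addr0 cosBpihalf cosD sinD; ring.
- rewrite -RintegralD//.
  apply: eq_Rintegral => y _; rewrite /propagator_fourier /A /B /expi.
  case: (dist_fourier T y) => u v /=.
  by rewrite addr0 cosBpihalf cosD sinD; ring.
Qed.

End Assembly.

Theorem theorem3p1 (R : realType) (a : R) (ha : 0 < a) (ha1 : a != 1) :
  exists2 C : R, 0 < C &
    forall u0 : functional R,
      hdot ((1 - a) / 2) u0 ->
      hdot ((1 - a) / 2) (scaling_field a u0) ->
      forall t y : R, 0 < t -> (a < 1 -> y != 0) ->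
        solution_converges a u0 t (y * t `^ a^-1) /\
        cabs (solution a u0 t (y * t `^ a^-1)) <=
          C * (1 + `|y| `^ (- a / (4 * (1 - a)))) * t `^ (- (1 / 2)) *
          (hdot_norm ((1 - a) / 2) u0 +
           hdot_norm ((1 - a) / 2) (scaling_field a u0)).
Proof.
have [C C0 hC] := symmetric_osc_cvg ha ha1.
(* The modulus is at most the sum of the absolute values of the real and imaginary parts, each made
   of two real oscillatory integrals. *)
exists (4 * C); first by pos.
move=> u0 [_ /dist_fourier_density df _] [_ /dist_fourier_density dg gfin] t y t0 _.
set x := y * _.
have [wr wi] := scaling_field_weak_euler df dg.
have [lf _] := df; have [lg _] := dg.
pose h := dist_fourier (scaling_field a u0).
pose E := hdot_energy ((1 - a) / 2) (scaling_field a u0).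
pose n := hdot_norm ((1 - a) / 2) (scaling_field a u0).
have E0 : (0 <= E)%E.
  by apply: integral_ge0 => z _; rewrite lee_fin mulr_ge0 ?powR_ge0 ?sqr_ge0.
have En : E = (n ^+ 2)%:E.
  rewrite /n /hdot_norm sqr_sqrtr ?fine_ge0// fineK// ge0_fin_numE//.
have n0 : 0 <= n by exact: sqrtr_ge0.
have [lgr lgi] := lg; have [lfr lfi] := lf.
have [mgr _ _] := lgr; have [mgi _ _] := lgi.
have mw : measurable_fun setT (fun z : R => `|z| `^ (1 - a)).
  by apply: (measurableT_comp (@measurable_powR _ _)).
have EE : E = (\int[lebesgue_measure]_z (`|z| `^ (1 - a) *
   (complex.Re (h z) ^+ 2 + complex.Im (h z) ^+ 2))%:E)%E.
  apply: eq_integral => z _; rewrite -/h cabs_sqr; congr (_ `^ _ * _)%:E.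
  by rewrite mulrC divfK.
have Er : (\int[lebesgue_measure]_z (`|z| `^ (1 - a) * complex.Re (h z) ^+ 2)%:E <= E)%E.
  rewrite EE; apply: ge0_le_integral => //.
  - by move=> z _; rewrite lee_fin mulr_ge0 ?powR_ge0 ?sqr_ge0.
  - by apply/measurable_EFinP; apply: measurable_funM => //; exact: measurable_funX.
  - apply/measurable_EFinP; apply: measurable_funM => //.
    by apply: measurable_funD; exact: measurable_funX.
  - by move=> z _; rewrite lee_fin ler_wpM2l ?powR_ge0// lerDl sqr_ge0.
have Ei : (\int[lebesgue_measure]_z (`|z| `^ (1 - a) * complex.Im (h z) ^+ 2)%:E <= E)%E.
  rewrite EE; apply: ge0_le_integral => //.
  - by move=> z _; rewrite lee_fin mulr_ge0 ?powR_ge0 ?sqr_ge0.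
  - by apply/measurable_EFinP; apply: measurable_funM => //; exact: measurable_funX.
  - apply/measurable_EFinP; apply: measurable_funM => //.
    by apply: measurable_funD; exact: measurable_funX.
  - by move=> z _; rewrite lee_fin ler_wpM2l ?powR_ge0// lerDr sqr_ge0.
(* The norm [n] may be 0 while the estimates ask for a positive bound; hence every [N > n] is used,
   and the limit [N -> n] is taken at the end. *)
have key N : n < N -> solution_converges a u0 t x /\
    cabs (solution a u0 t x) <= 4 * (C * N / Num.sqrt t).
  move=> nN; have N0 : 0 < N by exact: le_lt_trans nN.
  have EN : (E <= (N ^+ 2)%:E)%E by rewrite En lee_fin lerXn2r ?nnegrE ?(ltW N0) ?(ltW nN).
  have [l1 c1 b1] := hC _ _ N x t 0 N0 t0 lfr lgr wr (le_trans Er EN).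
  have [l2 c2 b2] := hC _ _ N x t (- (pi / 2)) N0 t0 lfi lgi wi (le_trans Ei EN).
  have [l3 c3 b3] := hC _ _ N x t 0 N0 t0 lfi lgi wi (le_trans Ei EN).
  have [l4 c4 b4] := hC _ _ N x t (- (pi / 2)) N0 t0 lfr lgr wr (le_trans Er EN).
  have cr : complex.Re (truncated_solution a u0 t x r) @[r --> +oo] --> l1 - l2.
    by under eq_fun do rewrite (truncated_solutionE _ _ _ _ lf).1; exact: cvgB c1 c2.
  have ci : complex.Im (truncated_solution a u0 t x r) @[r --> +oo] --> l3 + l4.
    by under eq_fun do rewrite (truncated_solutionE _ _ _ _ lf).2; exact: cvgD c3 c4.
  split; first by split; apply/cvg_ex; [exists (l1 - l2)|exists (l3 + l4)].
  rewrite /solution (cvg_lim _ cr)// (cvg_lim _ ci)//.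
  apply: le_trans (cabs_le _ _) _.
  have := ler_normB l1 l2; have := ler_normD l3 l4.
  by move: b1 b2 b3 b4; set u := C * N / _; lra.
have n1 : n < n + 1 by rewrite ltrDl.
split; first exact: (key _ n1).1.
have st : 0 < Num.sqrt t by rewrite sqrtr_gt0.
have bound : cabs (solution a u0 t x) <= 4 * C * n / Num.sqrt t.
  apply/ler_addgt0Pr => e e0.
  (* Enlarging [n] by this amount raises the bound [4 C n / sqrt t] by exactly [e]. *)
  have d0 : 0 < e * Num.sqrt t / (4 * C) by pos.
  have nd : n < n + e * Num.sqrt t / (4 * C) by rewrite ltrDl.
  apply: le_trans (key _ nd).2 _; rewrite le_eqVlt; apply/orP; left; apply/eqP.
  by field; rewrite !gt_eqF.
apply: le_trans bound _.
rewrite div1r powRN powR12_sqrt ?(ltW t0)//.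
have m0 : 0 <= hdot_norm ((1 - a) / 2) u0 by exact: sqrtr_ge0.
set w := `|y| `^ _; have w0 : 0 <= w by exact: powR_ge0.
set m := hdot_norm _ u0.
have k0 : 0 <= 4 * C / Num.sqrt t by pos.
rewrite (_ : 4 * C * n / _ = 4 * C / Num.sqrt t * n); last by ring.
rewrite (_ : _ * (m + _) = 4 * C / Num.sqrt t * ((1 + w) * (m + n))); last first.
  by rewrite -/n; ring.
apply: ler_wpM2l => //.
apply: (@le_trans _ _ (m + n)); first by rewrite lerDr.
by apply: ler_peMl; [exact: addr_ge0|rewrite lerDl].
Qed.
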